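(* Suppose $X$ and $Y$ are one-sided shifts of finite type and that they are continuously orbit equivalent. Then the associated two-sided shift spaces $\mathbf{X}$ and $\mathbf{Y}$ are flow equivalent.
   Context: $\mathbb{N}$ is the set of positive integers and $\mathbb{N}_0$ the set of non-negative integers. One-sided shift space: a closed subset $X\subseteq \boldsymbol{a}^{\mathbb{N}_0}$ ($\boldsymbol{a}$ a finite discrete alphabet, product topology) with $\sigma(X)=X$, where $(\sigma(x))_j=x_{j+1}$; $\sigma_X$ is the restriction of $\sigma$ to $X$. $\mathcal{L}(X)$ is the set of finite words (including the empty word) appearing in elements of $X$. $X$ is a one-sided shift of finite type if there is $m\in\mathbb{N}$ such that whenever $v\in\mathcal{L}(X)$ has length $m$ and $uv,vw\in\mathcal{L}(X)$, then $uvw\in\mathcal{L}(X)$. $X$ and $Y$ are continuously orbit equivalent if there is a homeomorphism $h:X\to Y$ and continuous maps $k,l:X\to\mathbb{N}_0$, $k',l':Y\to\mathbb{N}_0$ with $\sigma_Y^{k(x)}(h(\sigma_X(x)))=\sigma_Y^{l(x)}(h(x))$ for all $x\in X$ and $\sigma_X^{k'(y)}(h^{-1}(\sigma_Y(y)))=\sigma_X^{l'(y)}(h^{-1}(y))$ for all $y\in Y$. The two-sided shift space associated to $X$ is $\mathbf{X}:=\{\mathbf{x}\in\boldsymbol{a}^{\mathbb{Z}}:(x_m,x_{m+1},\dots)\in X\text{ for all }m\in\mathbb{Z}\}$ with shift $\sigma_{\mathbf{X}}$, $(\sigma_{\mathbf{X}}(\mathbf{x}))_j=x_{j+1}$. Its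 suspension $S\mathbf{X}$ is the quotient (with quotient topology) of $\mathbf{X}\times\mathbb{R}$ by the smallest equivalence relation with $(\sigma_{\mathbf{X}}^n(\mathbf{x}),t)\sim(\mathbf{x},t+n)$ for $\mathbf{x}\in\mathbf{X}$, $t\in\mathbb{R}$, $n\in\mathbb{Z}$. $\mathbf{X}$ and $\mathbf{Y}$ are flow equivalent if there is a homeomorphism $\psi:S\mathbf{X}\to S\mathbf{Y}$ mapping flow lines onto flow lines in an orientation preserving way: whenever $\psi([(\mathbf{x},t)])=[(\mathbf{y},r)]$ and $s,u>0$, there are $v>0$ with $\psi([(\mathbf{x},t+s)])=[(\mathbf{y},r+v)]$ and $w>0$ with $\psi^{-1}([(\mathbf{y},r+u)])=[(\mathbf{x},t+w)]$. *)

(* Defs.v *)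
From HB Require Import structures.
From Stdlib Require Relation_Operators.
From mathcomp Require Import all_boot all_order all_algebra.
From mathcomp Require Import all_classical all_reals all_analysis.
Set Implicit Arguments.
Unset Strict Implicit.
Unset Printing Implicit Defensive.
Import Order.TTheory GRing.Theory Num.Theory.
Import numFieldNormedType.Exports.

Local Open Scope classical_set_scope.
Local Open Scope ring_scope.
Local Open Scope quotient_scope.

Notation full_shift I a := {ptws I -> discrete_topology a}.

Definition homeomorphic_by (S T : topologicalType) (f : S -> T) (g : T -> S) :=
  [/\ continuous f, continuous g, cancel f g & cancel g f].

Section OneSided.
Variable a : finType.

Definition shift (x : full_shift nat a) : full_shift nat a := fun j => x j.+1.

Record one_sided_shift := OneSidedShift {
  shift_points :> set (full_shift nat a);
  shift_points_closed : closed shift_points;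
  shift_points_onto : shift @` shift_points = shift_points }.

Variable X : one_sided_shift.

Lemma shift_mem (x : X) : shift (\val x) \in (X : set _).
Proof.
apply/mem_set; have := set_mem (valP x); move: (\val x) => z Xz.
by rewrite -(shift_points_onto X); exists z.
Qed.

Definition shift_map (x : X) : X := exist _ (shift (\val x)) (shift_mem x).

Definition word_at (x : full_shift nat a) (i n : nat) : seq a :=
  mkseq (fun j => x (i + j)%N) n.

Definition language : set (seq a) :=
  [set u | exists x, shift_points X x /\ exists i, u = word_at x i (size u)].

Definition is_sft : Prop :=
  exists2 m : nat, (0 < m)%N & forall u v w : seq a, size v = m ->
    language v -> language (u ++ v) -> language (v ++ w) ->
    language (u ++ v ++ w).

End OneSided.

Definition continuously_orbit_equivalent (a b : finType)
    (X : one_sided_shift a) (Y : one_sided_shift b) : Prop :=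
  exists (h : X -> Y) (hinv : Y -> X) (k l : X -> nat) (k' l' : Y -> nat),
    [/\ homeomorphic_by h hinv,
        continuous k /\ continuous l,
        continuous k' /\ continuous l',
        forall x, iter (k x) (@shift_map _ Y) (h (shift_map x)) =
                  iter (l x) (@shift_map _ Y) (h x)
      & forall y, iter (k' y) (@shift_map _ X) (hinv (shift_map y)) =
                  iter (l' y) (@shift_map _ X) (hinv y)].

Section TwoSided.
Variables (a : finType) (X : one_sided_shift a).

Definition two_sided : set (full_shift int a) :=
  [set x | forall m : int, shift_points X (fun n : nat => x (m + n%:Z))].

(* The n-th power, n in Z, of the two-sided shift map [zshift 1]; see
   [zshift0] and [zshiftD]. *)
Definition zshift (n : int) (x : full_shift int a) : full_shift int a :=
  fun j => x (j + n).

Lemma zshift0 x : zshift 0 x = x.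
Proof. by apply/funext => j; rewrite /zshift addr0. Qed.

Lemma zshiftD m n x : zshift (m + n) x = zshift m (zshift n x).
Proof. by apply/funext => j; rewrite /zshift addrA. Qed.

Lemma zshift_mem (n : int) (x : two_sided) : zshift n (\val x) \in two_sided.
Proof.
apply/mem_set => m; have /(_ (m + n)) := set_mem (valP x).
by congr (shift_points X _); apply/funext => i; rewrite /zshift addrAC.
Qed.

Definition zshift_map (n : int) (x : two_sided) : two_sided :=
  exist _ (zshift n (\val x)) (zshift_mem n x).

Variable R : realType.

Definition suspension_step (p q : (two_sided * R)%type) : Prop :=
  exists (x : two_sided) (t : R) (n : int),
    p = (zshift_map n x, t) /\ q = (x, t + n%:~R).

Definition suspension_rel (p q : (two_sided * R)%type) : bool :=
  `[< Relation_Operators.clos_refl_sym_trans _ suspension_step p q >].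

Lemma suspension_rel_refl : reflexive suspension_rel.
Proof. by move=> p; apply/asboolP; exact: Relation_Operators.rst_refl. Qed.

Lemma suspension_rel_sym : symmetric suspension_rel.
Proof.
by move=> p q; apply/asboolP/asboolP; exact: Relation_Operators.rst_sym.
Qed.

Lemma suspension_rel_trans : transitive suspension_rel.
Proof.
move=> q p r /asboolP pq /asboolP qr; apply/asboolP.
exact: Relation_Operators.rst_trans pq qr.
Qed.

Definition suspension_equiv :=
  EquivRel suspension_rel suspension_rel_refl suspension_rel_sym
    suspension_rel_trans.

Definition suspension : topologicalType :=
  quotient_topology {eq_quot suspension_equiv}.

Definition suspension_class (x : two_sided) (t : R) : suspension :=
  \pi_{eq_quot suspension_equiv} (x, t).

End TwoSided.

(* Flow equivalence of [two_sided X] and [two_sided Y]. *)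
Definition flow_equivalent (R : realType) (a b : finType)
    (X : one_sided_shift a) (Y : one_sided_shift b) : Prop :=
  exists (psi : suspension X R -> suspension Y R)
         (psiinv : suspension Y R -> suspension X R),
    homeomorphic_by psi psiinv /\
    forall (x : two_sided X) (t : R) (y : two_sided Y) (r : R),
      psi (suspension_class x t) = suspension_class y r ->
      forall s u : R, 0 < s -> 0 < u ->
        (exists2 v : R, 0 < v &
           psi (suspension_class x (t + s)) = suspension_class y (r + v)) /\
        (exists2 w : R, 0 < w &
           psiinv (suspension_class y (r + u)) = suspension_class x (t + w)).

(* Main.v *)
(* Let [h] be the orbit equivalence and [c = l - k]: the points [h x] and
   [h (shift x)] agree far to the right once the second is moved by [c x].  For
   a two-sided point [x], place the one-sided points [h x_[n, oo)] at the
   positions given by the sums of [c] along the orbit.  If these sums tend to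
   -oo as n -> -oo, the placed points agree on larger and larger half-lines and
   define a two-sided point [code x], and [code] maps orbits to orbits.

   The sums behave well as soon as the sum of [c] over each periodic orbit of
   [X] is positive, since long orbit segments decompose into loops.  In fact one
   can have this sum equal to the least eventual period of [h x]: near a
   non-isolated periodic point it is forced, by comparing the insertion of one
   period in [X] with its effect in [Y], and the finitely many isolated periodic
   orbits can be corrected by hand.  Exactness of the sums is what makes the
   flow injective on closed orbits.

   The flow equivalence sends (x, t) to (code x, time x t), where [time x] is
   the piecewise linear interpolation of the averaged sums of [c].  It is a
   continuous closed bijection of suspensions. *)
Require Import Defs.
From mathcomp Require Import all_boot all_order all_algebra.
From mathcomp Require Import all_classical all_reals all_analysis.
From mathcomp Require Import zify ring lra.
Set Implicit Arguments.
Unset Strict Implicit.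
Unset Printing Implicit Defensive.
Import Order.TTheory GRing.Theory Num.Theory.
Import numFieldNormedType.Exports.
Local Open Scope classical_set_scope.
Local Open Scope ring_scope.

(** * Cylinder topology on sets of sequences *)

Section Cylinders.
Variables (I : choiceType) (a : finType) (A : set (full_shift I a)).
Variable w : I -> nat.
Hypothesis w_finite : forall M, exists s : seq I, forall i, (w i < M)%N -> i \in s.

(** The weight [w] is the identity on [nat] and [absz] on [int]: one notion covers prefixes of
    one-sided points and central windows of two-sided points. *)
Definition agree_below M (x z : I -> a) := forall i, (w i < M)%N -> x i = z i.

Lemma letter_continuous (i : I) :
  continuous (fun x : A => (\val x : full_shift I a) i : discrete_topology a).
Proof.
move=> x; apply: (@continuous_comp _ _ _ (set_val : A -> full_shift I a) (proj i)).
  exact: initial_continuous.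
exact: proj_continuous.
Qed.

Lemma cylinder_nbhs (x : A) M : nbhs x [set z : A | agree_below M (\val x) (\val z)].
Proof.
have [s sP] := w_finite M.
have : nbhs x [set z : A | forall i, i \in s -> (\val x : _ -> _) i = (\val z : _ -> _) i].
  elim: s {sP} => [|i s IH]; first by apply: filterE.
  have Hi : nbhs x [set z : A | (\val x : _ -> _) i = (\val z : _ -> _) i].
    by apply: (@letter_continuous i x); apply/principal_filterP.
  apply: filterS (filterI Hi IH) => z [/= h1 h2] j.
  by rewrite inE => /orP[/eqP->//|/h2].
by apply: filterS => z /= h i /sP/h.
Qed.

(** Otherwise points outside [U], one from each cylinder around [x], would converge to [x]
    coordinatewise, hence in the product topology. *)
Lemma nbhs_cylinder (x : A) U : nbhs x U ->
  exists M, forall z : A, agree_below M (\val x) (\val z) -> U z.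
Proof.
move=> xU; apply: contrapT => /forallNP/= H.
have {H}/choice[u uP] : forall M, exists z : A, agree_below M (\val x) (\val z) /\ ~ U z.
  by move=> M; have /existsNP[z /not_implyP] := H M; exists z.
suff ux : u @ \oo --> x.
  have [N _ /(_ N)/=] := ux _ xU; move/(_ (leqnn _)).
  by have [] := uP N.
rewrite /cvg_to /= => V; rewrite nbhsE => -[Q [[W oW <-] /= xW] WV].
have ucvg : (fun n => \val (u n) : full_shift I a) @ \oo --> (\val x : full_shift I a).
  apply/cvg_sup => i; apply/cvg_image.
    by apply/seteqP; split=> // y _; exists (fun=> y).
  move=> Y /principal_filterP Yx.
  exists [set z : full_shift I a | Y (z i)]; last first.
    by apply/seteqP; split => [y [z /= Yz <-]|y Yy]; last by exists (fun=> y).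
  exists (w i).+1 => // n /= wn; have [/(_ i wn) <- _] := uP n.
  exact: Yx.
have [N _ HN] := ucvg W (open_nbhs_nbhs (conj oW xW)).
by exists N => // n /HN /= ?; apply: WV.
Qed.

Lemma closed_compact_setT : closed A -> compact [set: A].
Proof.
move=> cA.
have cptA : compact A.
  have := @tychonoff I (fun _ => discrete_topology a) (fun=> setT).
  have cA1 : compact [set: discrete_topology a].
    by apply: finite_compact; exact: (@finite_finset a).
  move=> /(_ (fun=> cA1)) cT.
  exact: subclosed_compact cA cT _.
move=> F FF _.
have /cptA : ProperFilter ((set_val : A -> full_shift I a) @ F) by typeclasses eauto.
case; first by apply: (@filterE _ F) => x /=; exact: set_valP.
move=> p [Ap clp]; exists (exist _ p (mem_set Ap)); split=> // U V FU.
rewrite nbhsE => -[Q [[W oW <-] /= pW] WV].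
have [] := clp (set_val @` U) W.
- by apply: (@filterS _ F _ U) => // x Ux; exists x.
- exact: open_nbhs_nbhs.
by move=> _ [[x Ux <-] Wx]; exists x; split => //; exact: WV.
Qed.

(** By compactness, pairs that agree on ever larger windows but have different values would cluster
    at a point near which [f] is constant. *)
Lemma loc_const_uniform (T : Type) (f : A -> T) : closed A ->
  (forall x : A, nbhs x [set z | f z = f x]) ->
  exists M, forall x z : A, agree_below M (\val x) (\val z) -> f x = f z.
Proof.
move=> /closed_compact_setT cA fP; apply: contrapT => /forallNP/= H.
have {H}/choice[u uP] : forall M, exists xz : A * A,
    agree_below M (\val xz.1) (\val xz.2) /\ f xz.1 <> f xz.2.
  move=> M; have /existsNP[x /existsNP[z /not_implyP]] := H M.
  by move=> ?; exists (x, z).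
have [] := cA ((fun n => (u n).1) @ \oo); first exact: filterT.
move=> p [_ clp]; have [M MP] := nbhs_cylinder (fP p).
have [] := clp [set (u n).1 | n in [set n | (M <= n)%N]] _ _ (cylinder_nbhs p M).
  by exists M => // n /= Mn; exists n.
move=> _ [[n /= Mn <-] pn]; have [un] := uP n; case.
rewrite (MP (u n).1)//; apply/esym/MP => i iM.
by apply: etrans (pn i iM) (un i _); exact: leq_trans Mn.
Qed.

Lemma closed_limit (z : I -> a) : closed A ->
  (forall M, exists x : A, agree_below M z (\val x)) -> exists x : A, \val x = z.
Proof.
move=> /closed_compact_setT cA /choice[u uP].
have [] := cA (u @ \oo); first exact: filterT.
move=> p [_ clp]; exists p; apply/funext => i.
have [] := clp [set u n | n in [set n | (w i < n)%N]] _ _ (cylinder_nbhs p (w i).+1).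
  by exists (w i).+1 => // n /= Mn; exists n.
move=> _ [[n /= Mn <-] pn]; apply: etrans (pn i _) _ => //.
by apply/esym/uP.
Qed.

End Cylinders.

(** * Lags and eventual periods *)

Notation agree := (agree_below (fun i : nat => i)).

Section Lags.
Variable a : finType.
Implicit Types u v : nat -> a.

(* [v] is, up to a prefix, [u] shifted by [d] (backwards when [d < 0]). *)
Definition lag (B : nat) (d : int) u v :=
  forall i j : nat, (B <= i)%N -> (B <= j)%N -> i%:Z = j%:Z + d -> u i = v j.

Lemma lag_le B B' d u v : (B <= B')%N -> lag B d u v -> lag B' d u v.
Proof. by move=> BB H i j Bi Bj; apply: H; exact: leq_trans BB _. Qed.

Lemma lag_sym B d u v : lag B d u v -> lag B (- d) v u.
Proof. by move=> H i j Bi Bj ij; apply/esym/H => //; lia. Qed.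

Lemma lag_trans B B' d d' u v w :
  lag B d u v -> lag B' d' v w -> lag (B + B' + `|d'|) (d + d') u w.
Proof.
move=> H H' i j Bi Bj ij.
(* The summand [|d'|] of the bound keeps the intermediate index [j + d'] beyond both thresholds. *)
have Hm : 0 <= j%:Z + d' by lia.
transitivity (v (absz (j%:Z + d'))); [apply: H|apply: H']; lia.
Qed.

Lemma lag0_agree B u v : lag B 0 u v -> agree B u v -> u = v.
Proof.
move=> H uv; apply/funext => i; have [/uv//|Bi] := ltnP i B.
by apply: H => //; lia.
Qed.

Lemma self_lag_inj B d u v : d != 0 -> lag B d u u -> lag B d v v ->
  agree (B + absz d) u v -> u = v.
Proof.
move=> d0 uu vv uv; apply/funext => i; elim/ltn_ind: i => i IH.
have [/uv//|Bi] := ltnP i (B + absz d).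
have back w : lag B d w w -> w i = w (i - absz d)%N.
  move=> ww; have [dp|dn] : 0 < d \/ d < 0 by lia.
    by apply: ww; lia.
  by apply/esym/ww; lia.
by rewrite (back u)// (back v)// IH//; lia.
Qed.

(* Eventual periods form a subgroup of the integers: 0 and negatives count. *)
Definition evper u (e : int) := exists B, lag B e u u.

Lemma evper_lag B d e u v : lag B d u v -> evper u e -> evper v e.
Proof.
move=> uv [B' uu]; eexists.
have := lag_trans (lag_trans (lag_sym uv) uu) uv.
by rewrite (_ : - d + e + d = e) //; [exact|lia].
Qed.

Lemma evperN u e : evper u e -> evper u (- e).
Proof. by case=> B /lag_sym; exists B. Qed.

Lemma evperD u e e' : evper u e -> evper u e' -> evper u (e + e').
Proof. by move=> [B H] [B' H']; eexists; exact: lag_trans H H'. Qed.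

Lemma evperM u e (k : int) : evper u e -> evper u (k * e).
Proof.
move=> ue.
have H (n : nat) : evper u (n%:Z * e).
  elim: n => [|n IH]; first by rewrite mul0r; exists 0%N => i j _ _ ?; congr u; lia.
  by rewrite (_ : _ * e = n%:Z * e + e); [exact: evperD|lia].
case: k => n; first exact: H.
by rewrite NegzE mulNr; exact: evperN.
Qed.

Lemma evper_least u (e : int) : e != 0 -> evper u e ->
  exists2 q : nat, (0 < q)%N & forall e', evper u e' <-> (q %| e')%Z.
Proof.
move=> e0 ue.
have ex : exists n, (0 < n)%N && `[< evper u n%:Z >].
  exists (absz (e)); rewrite absz_gt0 e0/=; apply/asboolP.
  have [->|->] : `|e|%:Z = e \/ `|e|%:Z = - e by lia.
    exact: ue.
  exact: evperN.
case: (ex_minnP ex) => q /andP[q0 /asboolP uq] qmin; exists q => // e'; split.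
  move=> ue'.
  have um : evper u (e' %% q%:Z)%Z.
    by rewrite /modz -mulNr; apply: evperD => //; exact: evperM.
  apply/dvdz_mod0P.
  have m0 : 0 <= (e' %% q%:Z)%Z by apply: modz_ge0; lia.
  have mq : (e' %% q%:Z)%Z < q%:Z by apply: ltz_pmod; lia.
  have := qmin (absz ((e' %% q%:Z)%Z)).
  have [->//|n0] := eqVneq (e' %% q%:Z)%Z 0.
  rewrite absz_gt0 n0/= gez0_abs// => /(_ (asboolT um)); lia.
by move=> /dvdzP[k ->]; exact: evperM.
Qed.

Definition first_difference u v (N : nat) := agree N u v /\ u N <> v N.

Lemma first_difference_ex u v : u <> v -> exists N, first_difference u v N.
Proof.
move=> uv.
have ex : exists n, u n != v n.
  apply: contrapT => /forallNP H; apply: uv; apply/funext => i.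
  by have /negP := H i; rewrite negbK => /eqP.
case: (ex_minnP ex) => N /eqP uN Nmin; exists N; split=> // i iN.
by apply/eqP; apply: contraTT iN => /Nmin; rewrite -leqNgt.
Qed.

Lemma first_difference_uniq u v N N' : first_difference u v N -> first_difference u v N' -> N = N'.
Proof.
move=> [H1 H2] [H1' H2'].
have [NN'|NN'|//] := ltngtP N N'; first by case: H2; exact: H1'.
by case: H2'; exact: H1.
Qed.

Lemma first_difference_ge u v N M : first_difference u v N -> agree M u v -> (M <= N)%N.
Proof. by move=> [_ H] H'; rewrite leqNgt; apply/negP => /H'. Qed.

(** Far enough out, passing from [v] to [v'] is a shift by [d], which leaves [u] unchanged; so the
    place of parting from [u] moves by exactly [d]. *)
Lemma first_difference_lag B d u v v' N N' : lag B d u u -> lag B d v' v ->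
  agree (B + `|d|) u v -> agree (B + `|d|) u v' ->
  first_difference u v N -> first_difference u v' N' -> N'%:Z = N%:Z + d.
Proof.
move=> uu vv uv uv' dv dv'.
have := first_difference_ge dv uv; have := first_difference_ge dv' uv'.
case: dv dv' => [H1 H2] [H1' H2'] N'B NB.
case: (ltrgtP N'%:Z (N%:Z + d)) => // ltN.
  case: H2'; have Nd : N'%:Z - d = (absz (N'%:Z - d)) by lia.
  transitivity (u (absz (N'%:Z - d))); first by apply: uu; lia.
  transitivity (v (absz (N'%:Z - d))); first by apply: H1; lia.
  by apply/esym/vv; lia.
case: H2; have Nd : N%:Z + d = (absz (N%:Z + d)) by lia.
transitivity (u (absz (N%:Z + d))); first by apply/esym/uu; lia.
transitivity (v' (absz (N%:Z + d))); first by apply: H1'; lia.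
by apply: vv; lia.
Qed.

End Lags.

Lemma agreeW (a : finType) M N (u v : nat -> a) :
  (M <= N)%N -> agree N u v -> agree M u v.
Proof. by move=> MN H i iM; apply: H; exact: leq_trans MN. Qed.

Lemma agree_sym (a : finType) M (u v : nat -> a) : agree M u v -> agree M v u.
Proof. by move=> H i /H. Qed.

(** * One-sided shifts of finite type *)

Section OneSided.
Variables (a : finType) (X : one_sided_shift a).
Implicit Types x z : X.
Local Notation sh := (@shift_map a X).

Definition letters x : nat -> a := \val x.

Lemma letters_inj : injective letters.
Proof. exact: val_inj. Qed.

Lemma letters_iter n x i : letters (iter n sh x) i = letters x (n + i).
Proof.
elim: n i => [//|n IH] i; rewrite iterS.
by transitivity (letters (iter n sh x) i.+1) => //; rewrite IH addnS.
Qed.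

Lemma letters_lim (z : nat -> a) :
  (forall M, exists x, agree M z (letters x)) -> exists x, letters x = z.
Proof.
apply: closed_limit; last exact: shift_points_closed.
by move=> M; exists (iota 0 M) => i; rewrite mem_iota.
Qed.

(* Sliding-window form of finite type with memory [m]. *)
Definition memory m := forall z : nat -> a,
  (forall i, exists x j, forall t, (t <= m)%N -> z (i + t)%N = letters x (j + t)%N) ->
  exists x, letters x = z.

Lemma language_word x i n : language X (word_at (letters x) i n).
Proof.
exists (letters x); split; first exact: set_valP.
by exists i; rewrite size_mkseq.
Qed.

Lemma word_atD (u : nat -> a) i m n :
  word_at u i (m + n) = word_at u i m ++ word_at u (i + m) n.
Proof.
rewrite /word_at /mkseq iotaD map_cat add0n; congr (_ ++ _).
rewrite -{1}[m]addn0 iotaDl -map_comp; apply: eq_map => t /=.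
by rewrite addnA.
Qed.

Lemma eq_word_at (u v : nat -> a) i j n :
  (forall t, (t < n)%N -> u (i + t)%N = v (j + t)%N) ->
  word_at u i n = word_at v j n.
Proof.
move=> H; apply/eq_in_map => t; rewrite mem_iota add0n => /H.
exact.
Qed.

Lemma word_at_eq (u v : nat -> a) i j n : word_at u i n = word_at v j n ->
  forall t, (t < n)%N -> u (i + t)%N = v (j + t)%N.
Proof.
move=> H t tn; have := congr1 (fun s => nth (u i) s t) H.
by rewrite !nth_mkseq.
Qed.

Lemma sft_memory : is_sft X -> exists m, memory m.
Proof.
case=> m _ Hm; exists m => z zP.
have zword n i : language X (word_at z i n).
  elim/ltn_ind: n i => n IH i; have [nm|mn] := leqP n m.+1.
    have [x [j xj]] := zP i; rewrite (@eq_word_at _ (letters x) i j); last first.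
      by move=> t tn; apply: xj; lia.
    exact: language_word.
  (* One letter, a middle word of length [m] and the rest: the finite type condition glues two
     shorter words that overlap in the middle. *)
  rewrite (_ : n = 1 + (m + (n - m.+1)))%N; last lia.
  rewrite 2!word_atD; apply: Hm.
  - by rewrite size_mkseq.
  - by apply: IH; lia.
  - by rewrite -word_atD; apply: IH; lia.
  - by rewrite -word_atD; apply: IH; lia.
apply: letters_lim => M; have [x [Xx [i]]] := zword M 0%N.
rewrite size_mkseq => /word_at_eq H.
exists (iter i sh (exist _ x (mem_set Xx))) => t tM.
by rewrite letters_iter; exact: H.
Qed.

Definition locally_const (T : Type) (f : X -> T) :=
  exists M, forall x z, agree M (letters x) (letters z) -> f x = f z.

Lemma locally_constP (T : Type) (f : X -> T) :
  (forall x, nbhs x [set z | f z = f x]) -> locally_const f.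
Proof.
move=> fP; apply: loc_const_uniform => //; last exact: shift_points_closed.
by move=> M; exists (iota 0 M) => i; rewrite mem_iota.
Qed.

Lemma locally_const_bounded (f : X -> nat) :
  locally_const f -> exists B, forall x, (f x <= B)%N.
Proof.
move=> [M fM].
pose P (t : M.-tuple a) x := forall i : 'I_M, letters x i = tnth t i.
(* [f] as a function of the first [M] letters, with value 0 on words that start no point. *)
have /choice[g gP] : forall t, exists n, forall x, P t x -> f x = n.
  move=> t; have [[x Px]|nP] := pselect (exists x, P t x); last first.
    by exists 0%N => x Px; case: nP; exists x.
  exists (f x) => z Pz; apply: fM => i iM.
  by rewrite (Px (Ordinal iM)) (Pz (Ordinal iM)).
exists (\max_t g t) => x.
rewrite (gP [tuple of mkseq (letters x) M] x); last first.
  by move=> i; rewrite (tnth_nth (letters x i)) nth_mkseq.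
exact: leq_bigmax.
Qed.

Lemma locally_const_comp2 (T U V : Type) (f : X -> T) (g : X -> U) (k : T -> U -> V) :
  locally_const f -> locally_const g -> locally_const (fun x => k (f x) (g x)).
Proof.
move=> [M fM] [N gN]; exists (maxn M N) => x z xz; congr k.
  by apply: fM; apply: agreeW xz; lia.
by apply: gN; apply: agreeW xz; lia.
Qed.

Lemma locally_const_iter (T : Type) (f : X -> T) n :
  locally_const f -> locally_const (fun x => f (iter n sh x)).
Proof.
move=> [M fM]; exists (n + M)%N => x z xz; apply: fM => i iM.
by rewrite !letters_iter; apply: xz; lia.
Qed.

Definition birkhoff (c : X -> int) n x := \sum_(i < n) c (iter i sh x).

Lemma birkhoff0 c x : birkhoff c 0 x = 0.
Proof. by rewrite /birkhoff big_ord0. Qed.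

Lemma birkhoffS c n x : birkhoff c n.+1 x = birkhoff c n x + c (iter n sh x).
Proof. by rewrite /birkhoff big_ord_recr. Qed.

Lemma birkhoffD c m n x :
  birkhoff c (m + n) x = birkhoff c m x + birkhoff c n (iter m sh x).
Proof.
elim: n => [|n IH]; first by rewrite addn0 birkhoff0 addr0.
by rewrite addnS !birkhoffS IH addrA -iterD addnC.
Qed.

Lemma birkhoffM c k n x : iter n sh x = x ->
  birkhoff c (k * n) x = k%:Z * birkhoff c n x.
Proof.
move=> nx; elim: k => [|k IH]; first by rewrite birkhoff0 mul0r.
by rewrite mulSn birkhoffD nx IH; lia.
Qed.

Lemma birkhoff_locally_const c n : locally_const c -> locally_const (birkhoff c n).
Proof.
move=> cP; elim: n => [|n IH]; first by exists 0%N => x z _; rewrite !birkhoff0.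
have [M MP] := locally_const_comp2 +%R IH (locally_const_iter n cP).
by exists M => x z /MP; rewrite !birkhoffS.
Qed.

End OneSided.

(** * Lag cocycles and periodic points *)

Section LagCocycles.
Variables (a b : finType) (X : one_sided_shift a) (Y : one_sided_shift b).
Local Notation shX := (@shift_map a X).

Definition uniform_map (h : X -> Y) := forall K, exists M, forall x z : X,
  agree M (letters x) (letters z) -> agree K (letters (h x)) (letters (h z)).

Definition lag_cocycle (h : X -> Y) (c : X -> int) := locally_const c /\
  exists B, forall x, lag B (c x) (letters (h x)) (letters (h (shX x))).

Variables (h : X -> Y) (c : X -> int).
Hypothesis hc : lag_cocycle h c.

(** Lags compose along the orbit, and the threshold stays uniform because [c] is bounded. *)
Lemma birkhoff_lag n : exists B, forall x,
  lag B (birkhoff c n x) (letters (h x)) (letters (h (iter n shX x))).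
Proof.
have [cl [B BP]] := hc.
elim: n => [|n [B' IH]].
  by exists 0%N => x i j _ _; rewrite birkhoff0 => ij; congr letters; lia.
have [C CP] : exists C, forall x, (absz (c (iter n shX x)) <= C)%N.
  apply: locally_const_bounded; have [M MP] := locally_const_iter n cl.
  by exists M => x z /MP ->.
exists (B' + B + C)%N => x; rewrite birkhoffS iterS.
by apply: lag_le (lag_trans (IH x) (BP _)); have := CP x; lia.
Qed.

Lemma birkhoff_bound n : exists C, forall x, (absz (birkhoff c n x) <= C)%N.
Proof.
apply: locally_const_bounded; have [M MP] := birkhoff_locally_const n hc.1.
by exists M => x z /MP ->.
Qed.

Lemma birkhoff_lag_le n : exists B, forall k x, (k <= n)%N ->
  lag B (birkhoff c k x) (letters (h x)) (letters (h (iter k shX x))) /\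
  (absz (birkhoff c k x) <= B)%N.
Proof.
elim: n => [|n [B BP]].
  exists 0%N => k x; rewrite leqn0 => /eqP ->; rewrite birkhoff0; split=> //.
  by move=> i j _ _ ij; congr letters; lia.
have [B' B'P] := birkhoff_lag n.+1; have [C CP] := birkhoff_bound n.+1.
exists (B + B' + C)%N => k x; rewrite leq_eqVlt => /orP[/eqP->|kn].
  by split; [apply: lag_le (B'P x)|have := CP x]; lia.
by have [lB bB] := BP k x kn; split; [apply: lag_le lB|]; lia.
Qed.

End LagCocycles.

(** * Period sums at non-isolated periodic points *)

Section NonIsolated.
Variables (a b : finType) (X : one_sided_shift a) (Y : one_sided_shift b).
Local Notation shX := (@shift_map a X).
Local Notation shY := (@shift_map b Y).
Variables (h : X -> Y) (g : Y -> X) (c : X -> int) (c' : Y -> int).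
Hypotheses (hK : cancel h g) (gK : cancel g h).
Hypotheses (hu : uniform_map h) (gu : uniform_map g).
Hypotheses (hc : lag_cocycle h c) (gc : lag_cocycle g c').

Variables (m : nat).
Hypothesis Xm : memory X m.

Lemma periodic_letters p (x : X) i : iter p shX x = x ->
  letters x (i + p) = letters x i.
Proof. by move=> px; rewrite -{2}px letters_iter addnC. Qed.

(** As [z] starts with the same [m] letters as [x], each window of [m + 1] letters of the
    concatenation occurs in [x] or in [z]. *)
Lemma insert_period p (x z : X) : iter p shX x = x ->
  agree m (letters x) (letters z) ->
  exists2 z', letters z' = (fun i => if (i < p)%N then letters x i else letters z (i - p)%N)
            & iter p shX z' = z.
Proof.
move=> px xz.
have [i|z' z'E] := Xm (z := fun i => if (i < p)%N then letters x i else letters z (i - p)%N).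
  have [ip|pi] := ltnP i p; last first.
    exists z, (i - p)%N => t tm; rewrite ifF; last by apply/negbTE; lia.
    by congr letters; lia.
  exists x, i => t tm; case: ifPn => // /negbTE ipt.
  rewrite -xz; last lia.
  by rewrite -(periodic_letters _ px); congr letters; lia.
exists z' => //; apply: letters_inj; apply/funext => i.
by rewrite letters_iter z'E ifF; [congr letters|apply/negbTE]; lia.
Qed.

(** A nearby [z] is compared with the [z'] that has one more period in front. The first difference
    from [x] moves by [p], that of the images from [h x] by the period sum [D]. Contraction gives
    [0 < D]; transport through [g] shows that [D] is the least eventual period of [h x]. *)
Lemma birkhoff_nonisolated p (x : X) : (0 < p)%N -> iter p shX x = x ->
  (forall e, evper (letters x) e -> (p %| e)%Z) ->
  (forall M, exists2 z, agree M (letters x) (letters z) & z <> x) ->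
  0 < birkhoff c p x /\
  forall e, evper (letters (h x)) e -> (birkhoff c p x %| e)%Z.
Proof.
move=> p0 px pmin iso.
have [B0 B0P] := birkhoff_lag hc p.
pose least q := (0 < q)%N /\ forall e, evper (letters (h x)) e <-> (q %| e)%Z.
(* [Bq] is fixed before a least eventual period is known to exist, since [B] depends on it and
   serves to prove [0 < D], which yields [q]. *)
have [Bq BqP] : exists Bq, forall q : nat, least q ->
    lag Bq q (letters (h x)) (letters (h x)).
  have [[q [q0 qmin]]|nq] := pselect (exists q, least q); last first.
    by exists 0%N => q qP; case: nq; exists q.
  have [Bq BqP] : evper (letters (h x)) q by apply/qmin.
  exists Bq => q' [q'0 q'min].
  suff -> : q' = q by [].
  apply/eqP; rewrite eqn_dvd; apply/andP; split.
    by have /q'min := (qmin q).2 (dvdzz _); rewrite dvdzE.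
  by have /qmin := (q'min q').2 (dvdzz _); rewrite dvdzE.
pose B := (B0 + Bq)%N; pose D := birkhoff c p x.
have BP z : lag B (birkhoff c p z) (letters (h z)) (letters (h (iter p shX z))).
  by apply: lag_le (B0P z); lia.
have yD : lag B D (letters (h x)) (letters (h x)) by rewrite -{2}px; exact: BP.
have [M1 M1P] := birkhoff_locally_const p hc.1.
have [M2 M2P] := hu (B + absz D).
pose M := (m + M1 + M2)%N.
have ext z : agree M (letters x) (letters z) ->
    exists z', [/\ iter p shX z' = z, agree M (letters x) (letters z'),
      (forall N, first_difference (letters x) (letters z) N ->
         first_difference (letters x) (letters z') (N + p)) &
      lag B D (letters (h z')) (letters (h z))].
  move=> xz; have [|z' z'E pz'] := @insert_period p x z px.
    by apply: agreeW xz; lia.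
  have H N : agree N (letters x) (letters z) -> agree (N + p) (letters x) (letters z').
    move=> xzN i iN; rewrite z'E; case: ifPn => // /negbTE ip.
    rewrite -xzN; last lia.
    by rewrite -[RHS](periodic_letters _ px); congr letters; lia.
  have xz' : agree M (letters x) (letters z') by apply: agreeW (H _ xz); lia.
  exists z'; split=> //.
    move=> N [/H H1 H2]; split=> //.
    rewrite z'E ifF; last by apply/negbTE; lia.
    by rewrite periodic_letters// (_ : (N + p - p = N)%N); last lia.
  rewrite /D (M1P _ z'); last by apply: agreeW xz'; lia.
  by rewrite -pz'; exact: BP.
have hnear z : agree M (letters x) (letters z) ->
    agree (B + absz D) (letters (h x)) (letters (h z)).
  by move=> xz; apply: M2P; apply: agreeW xz; lia.
have hdiff z : z <> x -> exists N, first_difference (letters (h x)) (letters (h z)) N.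
  by move=> zx; apply: first_difference_ex => /letters_inj /(can_inj hK) /esym.
have ext_ne z z' : iter p shX z' = z -> z <> x -> z' <> x.
  by move=> pz' zx xz'; apply: zx; rewrite -pz' xz' px.
(* Inserting a period contracts towards [x], so its [h]-image contracts towards [h x]. *)
have Dpos : 0 < D.
  have [z0 xz0 z0x] := iso M.
  have Dneq : D <> 0.
    move=> D0; have [z' [_ xz' fd]] := ext _ xz0; rewrite D0.
    move/lag0_agree => hz; have [N Nz] : exists N, first_difference (letters x) (letters z0) N.
      by apply: first_difference_ex => /letters_inj/esym.
    have zz' : z' = z0.
      apply: (can_inj hK); apply: letters_inj; apply: hz.
      apply: (@agreeW _ _ (B + absz D)); first lia.
      by move=> i iB; rewrite -(hnear _ xz') // -(hnear _ xz0).
    by have := first_difference_uniq (fd _ Nz); rewrite zz' => /(_ _ Nz); lia.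
  suff : ~ D < 0 by lia.
  (* Descent: for negative [D] each insertion would bring the first difference of the images nearer
     to 0. *)
  move=> Dneg; have [N zN] := hdiff _ z0x.
  elim/ltn_ind: N z0 xz0 z0x zN => N IH z xz zx zN.
  have [z' [pz' xz' _ lz]] := ext _ xz.
  have z'x := ext_ne _ _ pz' zx; have [N' zN'] := hdiff _ z'x.
  have := first_difference_lag yD lz (hnear _ xz) (hnear _ xz') zN zN'.
  by move=> N'N; apply: (IH N' _ z') => //; lia.
have [q q0 qmin] : exists2 q : nat, (0 < q)%N &
    forall e, evper (letters (h x)) e <-> (q %| e)%Z.
  by apply: (@evper_least _ _ D); [lia|exists B].
have {}BqP := BqP q (conj q0 qmin).
have /dvdzP[j Dj] : (q %| D)%Z by apply/qmin; exists B.
have j0 : 0 < j by rewrite -(pmulr_lgt0 (x := q%:Z))//; lia.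
(* Transporting back the lag [D] between the images gives [p] on the one hand,
   and [j] times an eventual period of [x] on the other hand. *)
pose Dn := absz D; have DnE : D = Dn by lia.
pose E := birkhoff c' Dn (iter B shY (h x)).
have [B1 B1P] := birkhoff_lag gc (B + Dn).
have [B2 B2P] := birkhoff_lag gc B.
have [M3 M3P] := birkhoff_locally_const (B + Dn) gc.1.
have [M4 M4P] := birkhoff_locally_const B gc.1.
have [M5 M5P] := hu (M3 + M4).
(* [h z'] and [h z] meet after [B + D] and [B] shifts. Applying [g] gives as lag a difference of two
   sums of [c'], which by local constancy may be evaluated at [h x], where it is [E]. *)
have back z z' : lag B D (letters (h z')) (letters (h z)) ->
    agree (M + M5) (letters x) (letters z) -> agree (M + M5) (letters x) (letters z') ->
    lag (B1 + B2 + absz (birkhoff c' B (h x))) E (letters z') (letters z).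
  move=> lz xz xz'.
  have e : iter (B + Dn) shY (h z') = iter B shY (h z).
    apply: letters_inj; apply/funext => i; rewrite !letters_iter.
    by apply: lz; lia.
  have := lag_sym (B2P (h z)); rewrite -e => /(lag_trans (B1P (h z'))).
  have hz : agree (M3 + M4) (letters (h x)) (letters (h z)).
    by apply: M5P; apply: agreeW xz; lia.
  have hz' : agree (M3 + M4) (letters (h x)) (letters (h z')).
    by apply: M5P; apply: agreeW xz'; lia.
  rewrite !hK -(M4P (h x)); last by apply: agreeW hz; lia.
  rewrite -(M3P (h x)); last by apply: agreeW hz'; lia.
  by rewrite birkhoffD abszN addrAC subrr add0r.
have xE : lag (B1 + B2 + absz (birkhoff c' B (h x))) E (letters x) (letters x).
  exact: back.
have Ep : E = p.
  pose B' := (B1 + B2 + absz (birkhoff c' B (h x)) + absz E)%N.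
  have [z xz zx] := iso (M + M5 + B')%N.
  have [|z' [pz' _ fd lz]] := ext z; first by apply: agreeW xz; lia.
  have [N Nz] : exists N, first_difference (letters x) (letters z) N.
    by apply: first_difference_ex => /letters_inj/esym.
  have NM := first_difference_ge Nz xz.
  have xz' : agree (M + M5 + B') (letters x) (letters z').
    by apply: agreeW (fd _ Nz).1; lia.
  have /back lz' := lz.
  have {}lz' : lag (B1 + B2 + absz (birkhoff c' B (h x))) E (letters z') (letters z).
    by apply: lz'; [apply: agreeW xz|apply: agreeW xz']; lia.
  suff : (N + p)%N%:Z = N%:Z + E by lia.
  apply: first_difference_lag xE lz' _ _ Nz (fd _ Nz).
    by apply: agreeW xz; lia.
  by apply: agreeW xz'; lia.
pose E1 := birkhoff c' q (iter B shY (h x)).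
have qy : iter q shY (iter B shY (h x)) = iter B shY (h x).
  apply: letters_inj; apply/funext => i; rewrite !letters_iter.
  by apply: BqP; lia.
have EE1 : E = j * E1.
  have jn : j = absz j by lia.
  have Dnq : Dn = (absz j * q)%N by lia.
  by rewrite /E Dnq birkhoffM// -jn.
have /pmin/dvdzP[k kE] : evper (letters x) E1.
  have [B3 B3P] := birkhoff_lag gc q.
  apply: (@evper_lag _ B2 (- birkhoff c' B (h x)) _ (letters (g (iter B shY (h x))))).
    by have := lag_sym (B2P (h x)); rewrite hK.
  by exists B3; have := B3P (iter B shY (h x)); rewrite qy.
have jk : j * k = 1.
  have p0' : p%:Z != 0 by lia.
  by apply: (mulIf p0'); rewrite -mulrA -kE -EE1 Ep mul1r.
suff j1 : j = 1 by split=> // e /qmin; rewrite -/D Dj j1 mul1r.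
have : (j %| 1)%Z by apply/dvdzP; exists k; rewrite mulrC.
by rewrite dvdz1 => /eqP; lia.
Qed.

End NonIsolated.

Lemma pigeonhole_agree (a : finType) m : exists V, forall u : nat -> nat -> a,
  exists i j, (i < j <= V)%N /\ agree m (u i) (u j).
Proof.
exists #|{: m.-tuple a}| => u; set V := #|_|.
pose f (i : 'I_V.+1) := [tuple of mkseq (u i) m].
have : ~~ injectiveb f.
  apply: contraL (leqnn V) => /injectiveP fi; rewrite -ltnNge.
  by rewrite -[X in (X <= _)%N](card_ord V.+1); exact: leq_card fi.
case/injectivePn => i [j ij fij].
have agr : agree m (u i) (u j).
  move=> t tm; have := congr1 (fun s => tnth s (Ordinal tm)) fij.
  by rewrite !(tnth_nth (u i 0)) !nth_mkseq.
have [lij|lji|/val_inj e] := ltngtP i j; last by rewrite e eqxx in ij.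
- by exists i, j; split=> //; have := ltn_ord j; lia.
- by exists j, i; split; [have := ltn_ord i; lia|exact: agree_sym].
Qed.

(** * Cutting and closing loops, isolated points, least periods *)

Section Loops.
Variables (a : finType) (X : one_sided_shift a) (m : nat).
Local Notation sh := (@shift_map a X).
Hypothesis Xm : memory X m.
Implicit Types x z : X.

Lemma recurrent_word : exists V, forall x, exists i j, (i < j <= V)%N /\
  agree m (letters (iter i sh x)) (letters (iter j sh x)).
Proof.
have [V VP] := pigeonhole_agree a m.
by exists V => x; exact: VP (fun i => letters (iter i sh x)).
Qed.

(** The orbit shows the same [m] letters at [i] and at [j], so the joint creates no new window of
    [m + 1] letters. *)
Lemma cut_loop i j x : (i <= j)%N ->
  agree m (letters (iter i sh x)) (letters (iter j sh x)) ->
  exists z, letters z = fun s => if (s < i)%N then letters x s else letters x (s + (j - i)).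
Proof.
move=> ij xij; apply: Xm => s; have [si|is_] := ltnP s i; last first.
  by exists x, (s + (j - i))%N => t tm; rewrite ifF; [congr letters|apply/negbTE]; lia.
exists x, s => t tm; case: ifPn => // /negbTE sti.
have := xij (s + t - i)%N; rewrite !letters_iter.
by rewrite (_ : i + _ = s + t)%N 1?(_ : j + _ = s + t + (j - i))%N; [|lia..] => ->//; lia.
Qed.

(** The tail at [i] follows the periodic repetition of its first [j - i] letters for [j - i + m]
    places, so it contains every window of the repetition. *)
Lemma close_loop i j x : (i < j)%N ->
  agree m (letters (iter i sh x)) (letters (iter j sh x)) ->
  exists2 z, iter (j - i) sh z = z & agree (j - i + m) (letters (iter i sh x)) (letters z).
Proof.
move=> ij xij; pose d := (j - i)%N; pose x' := iter i sh x.
have {}xij : forall s, (s < m)%N -> letters x' s = letters x' (s + d).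
  by move=> s /xij; rewrite /x' !letters_iter => ->; congr letters; lia.
have per s : (s < d + m)%N -> letters x' s = letters x' (s %% d).
  elim/ltn_ind: s => s IH sd; have [sd'|ds] := ltnP s d; first by rewrite modn_small.
  rewrite -(subnK ds) modnDr -xij; last lia.
  by apply: IH; lia.
have d0 : (0 < d)%N by lia.
have [s|z zE] := Xm (z := fun s => letters x' (s %% d)).
  exists x', (s %% d)%N => t tm; rewrite -modnDml -per//.
  by have := ltn_pmod s d0; lia.
exists z; last by move=> s sd; rewrite zE; exact: per.
by apply: letters_inj; apply/funext => s; rewrite letters_iter zE modnDl.
Qed.

Definition isolated_pt x := exists M, forall z, agree M (letters x) (letters z) -> z = x.

(** Cutting a loop beyond the isolating prefix gives back [x], which therefore repeats from there
    on. *)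
Lemma isolated_evper x : isolated_pt x -> exists2 e : nat, (0 < e)%N & evper (letters x) e.
Proof.
case=> M xM; have [V VP] := recurrent_word.
have [i [j [/andP[ij _]]]] := VP (iter M sh x); rewrite -!iterD => H.
have [||z zE] := @cut_loop (M + i) (M + j) x; first lia.
  by rewrite addnC (addnC M j).
have zx : z = x by apply: xM => s sM; rewrite zE ifT//; lia.
exists (j - i)%N; first lia.
exists (M + i)%N => s t Ms Mt st; rewrite -{2}zx zE ifF; last by apply/negbTE; lia.
by congr letters; lia.
Qed.

(** With [M] periods inserted in front, [z] becomes a point sharing the isolating prefix of [x],
    hence [x] itself. The prefix length [m] thus serves all isolated periodic points at once. *)
Lemma isolated_periodic_prefix p x z : (0 < p)%N -> iter p sh x = x -> isolated_pt x ->
  agree m (letters x) (letters z) -> z = x.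
Proof.
move=> p0 px [M xM] xz.
have [|z' z'E <-] := insert_period Xm (p := (M * p)%N) _ xz.
  by elim: M {xM} => // M IH; rewrite mulSn iterD IH.
rewrite (xM z'); last by move=> i iM; rewrite z'E ifT//; nia.
by elim: M {xM z'E} => // M IH; rewrite mulSn iterD IH.
Qed.

Lemma isolated_iter n x : isolated_pt (iter n sh x) -> isolated_pt x.
Proof.
move=> [M xM]; exists (n + M)%N => z xz.
have nz : iter n sh z = iter n sh x.
  by apply: xM => i iM; rewrite !letters_iter; apply: xz; lia.
apply: letters_inj; apply/funext => i; have [ni|ni] := ltnP i n.
  by apply/esym/xz; lia.
by rewrite -(subnKC ni) -!letters_iter nz.
Qed.

Definition least_period p x := [/\ (0 < p)%N, iter p sh x = x &
  forall p', (0 < p')%N -> iter p' sh x = x -> (p <= p')%N].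

Lemma least_period_ex p x : (0 < p)%N -> iter p sh x = x -> exists q, least_period q x.
Proof.
move=> p0 px; have ex : exists n, (0 < n)%N && `[< iter n sh x = x >].
  by exists p; rewrite p0; apply/asboolP.
case: (ex_minnP ex) => q /andP[q0 /asboolP qx] qmin; exists q; split=> // p' p'0 p'x.
by apply: qmin; rewrite p'0; apply/asboolP.
Qed.

Lemma iter_periodM k p x : iter p sh x = x -> iter (k * p) sh x = x.
Proof. by move=> px; elim: k => // k IH; rewrite mulSn iterD IH. Qed.

Lemma iter_periodC p n x : iter p sh x = x -> iter p sh (iter n sh x) = iter n sh x.
Proof. by move=> px; rewrite -iterD addnC iterD px. Qed.

Lemma least_period_evper p x e : least_period p x -> evper (letters x) e -> (p %| e)%Z.
Proof.
move=> [p0 px pmin] xe.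
have xp : evper (letters x) p.
  by exists 0%N => i j _ _ ij; rewrite -(periodic_letters j px); congr letters; lia.
have [B] : evper (letters x) (e %% p)%Z.
  by rewrite /modz -mulNr; apply: evperD => //; exact: evperM.
have m0 : 0 <= (e %% p)%Z by apply: modz_ge0; lia.
have mp : (e %% p)%Z < p by apply: ltz_pmod; lia.
set r := (e %% p)%Z in m0 mp * => xr; apply/dvdz_mod0P; rewrite -/r.
have rx : iter (absz r) sh x = x.
  apply: letters_inj; apply/funext => i; rewrite letters_iter.
  rewrite -(periodic_letters i (iter_periodM B px)).
  rewrite -(periodic_letters (absz r + i) (iter_periodM B px)).
  by apply: xr; nia.
have [//|r0] := eqVneq r 0.
by have := pmin (absz r); rewrite rx => /(_ _ erefl); lia.
Qed.

Lemma least_period_iter p n x : least_period p x -> least_period p (iter n sh x).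
Proof.
move=> [p0 px pmin]; split=> //; first exact: iter_periodC.
move=> p' p'0 p'x; apply: pmin => //.
have xE : iter (n * p - n) sh (iter n sh x) = x.
  by rewrite -iterD subnK ?iter_periodM//; nia.
by rewrite -xE iter_periodC.
Qed.

Lemma birkhoff_rotate c p n x : iter p sh x = x ->
  birkhoff c p (iter n sh x) = birkhoff c p x.
Proof.
move=> px; have := birkhoffD c p n x; rewrite addnC birkhoffD px; lia.
Qed.

End Loops.

(** * Correction of the lag to a period-exact cocycle *)

Section ExactCocycle.
Variables (a b : finType) (X : one_sided_shift a) (Y : one_sided_shift b).
Local Notation sh := (@shift_map a X).
Variables (h : X -> Y).

(** For a lag cocycle the sum over a period is itself an eventual period of [h x]; dividing all
    others, it is the least positive one. *)
Definition period_exact (c : X -> int) := forall x p, least_period p x ->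
  0 < birkhoff c p x /\
  forall e, evper (letters (h x)) e -> (birkhoff c p x %| e)%Z.

Lemma evper_image_iter c n x e : lag_cocycle h c ->
  evper (letters (h (iter n sh x))) e -> evper (letters (h x)) e.
Proof.
move=> hc; have [B BP] := birkhoff_lag hc n.
by apply: evper_lag; apply: lag_sym; exact: BP.
Qed.

Lemma evper_birkhoff c p x : lag_cocycle h c -> iter p sh x = x ->
  evper (letters (h x)) (birkhoff c p x).
Proof.
move=> hc px; have [B /(_ x)] := birkhoff_lag hc p.
by rewrite px => ?; exists B.
Qed.

Variables (g : Y -> X) (c0 : X -> int) (c' : Y -> int).
Hypotheses (hK : cancel h g) (gK : cancel g h).
Hypotheses (hu : uniform_map h) (gu : uniform_map g).
Hypotheses (hc : lag_cocycle h c0) (gc : lag_cocycle g c').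
Variables (m m' : nat).
Hypotheses (Xm : memory X m) (Ym : memory Y m').

Let per_iso x := (exists2 p, (0 < p)%N & iter p sh x = x) /\ isolated_pt x.

Let per_iso_iter n x : per_iso x -> per_iso (iter n sh x).
Proof.
move=> [[p p0 px] ix]; split; first by exists p; [|exact: iter_periodC].
(* After [n] steps, [n * p - n] more complete [n] periods and return to [x]. *)
apply: (@isolated_iter _ _ (n * p - n)).
by rewrite -iterD subnK ?iter_periodM//; nia.
Qed.

Let isolated_image x : isolated_pt x -> isolated_pt (h x).
Proof.
move=> [M xM]; have [N NP] := gu M.
by exists N => y /NP; rewrite hK => /xM <-; rewrite gK.
Qed.

(** The image of an isolated point is isolated, hence has a least eventual period [q]. The
    correction, a difference of eventual periods, turns the period sum into [q]. *)
Let adjust x : exists d : int, per_iso x ->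
  evper (letters (h x)) d /\ forall p, least_period p x ->
    0 < birkhoff c0 p x + d /\
    forall e, evper (letters (h x)) e -> (birkhoff c0 p x + d %| e)%Z.
Proof.
have [[[p p0 px] ix]|nx] := pselect (per_iso x); last by exists 0.
have [e e0 ye] := isolated_evper Ym (isolated_image ix).
have [q q0 qmin] := evper_least (e := e) (u := letters (h x)) (ltac:(lia)) ye.
have [r rx] := least_period_ex p0 px.
exists (q%:Z - birkhoff c0 r x) => _; split.
  apply: evperD; first by apply/qmin; exact: dvdzz.
  apply: evperN; apply: evper_birkhoff => //; by case: rx.
move=> r' r'x; have -> : r' = r.
  case: rx r'x => [r0 rx rmin] [r'0 r'x r'min].
  by apply/eqP; rewrite eqn_leq rmin// r'min.
rewrite addrC subrK; split; first lia.
by move=> e' /qmin.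
Qed.

(** [choose] depends only on the set of iterates, which is common to all points of a periodic orbit;
    so each such orbit gets one marked point. *)
Let rep x : X := choose (fun z => `[< exists n, z = iter n sh x >]) x.

Let rep_iter x : exists n, rep x = iter n sh x.
Proof.
apply/asboolP.
by apply: (@chooseP _ (fun z => `[< exists n, z = iter n sh x >]) x); apply/asboolP; exists 0%N.
Qed.

Let rep_periodic n p x : (0 < p)%N -> iter p sh x = x -> rep (iter n sh x) = rep x.
Proof.
move=> p0 px.
have E : (fun z => `[< exists k, z = iter k sh (iter n sh x) >]) =
         (fun z => `[< exists k, z = iter k sh x >]).
  apply/funext => z; apply/asboolP/asboolP => -[k ->].
    by exists (k + n)%N; rewrite iterD.
  exists (k + (n * p - n))%N.
  by rewrite -iterD -addnA subnK ?iterD ?iter_periodM//; nia.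
rewrite /rep E; apply: choose_id; apply/asboolP; first by exists n.
by exists 0%N.
Qed.

(* On an isolated periodic orbit the lag may be changed at a single point by any
   eventual period of the image; elsewhere exactness is automatic. *)
Lemma exact_cocycle_ex : exists c, lag_cocycle h c /\ period_exact c.
Proof.
have /choice[d dP] := adjust.
pose special x := per_iso x /\ rep x = x.
pose c x := c0 x + (if `[< special x >] then d x else 0).
have [[M0 M0P] [B0 B0P]] := hc.
(* A special point is the only one with its first [m] letters, so local constancy need only be
   checked away from special points. *)
have c_const (T : Type) (f : X -> T) M : (forall x z, ~ special x -> ~ special z ->
    agree M (letters x) (letters z) -> f x = f z) -> locally_const f.
  move=> H; exists (m + M)%N => x z xz.
  have pz u v : agree (m + M) (letters u) (letters v) -> special u -> v = u.
    move=> uv [[[p p0 pu] iu] _]; apply: (isolated_periodic_prefix Xm p0 pu iu).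
    by apply: agreeW uv; lia.
  have [sx|sx] := pselect (special x); first by rewrite (pz x z).
  have [sz|sz] := pselect (special z).
    by rewrite (pz z x)//; exact: agree_sym.
  by apply: H => //; apply: agreeW xz; lia.
have ccN x : ~ special x -> c x = c0 x.
  by move=> sx; rewrite /c asboolF// addr0.
have cc : lag_cocycle h c.
  split.
    by apply: (c_const _ _ M0) => x z sx sz /M0P; rewrite !ccN.
  have /choice[Bf BfP] : forall x, exists B,
      lag B (c x) (letters (h x)) (letters (h (sh x))) /\ (~ special x -> B = B0).
    move=> x; have [sx|sx] := pselect (special x); last first.
      by exists B0; rewrite ccN.
    have [[B lB] _] := dP x sx.1.
    exists (B + B0 + absz (c0 x))%N; split=> //.
    by rewrite /c asboolT// addrC; apply: lag_trans (B0P x).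
  have [B BP] : exists B, forall x, (Bf x <= B)%N.
    apply: locally_const_bounded; apply: (c_const _ _ 0%N) => x z sx sz _.
    by rewrite (BfP x).2// (BfP z).2.
  by exists B => x; apply: lag_le (BP x) (BfP x).1.
exists c; split=> // x p px.
have [p0 ppx pmin] := px.
have [ix|nix] := pselect (isolated_pt x); last first.
  have -> : birkhoff c p x = birkhoff c0 p x.
    apply: eq_bigr => i _; apply: ccN => -[[_ /isolated_iter]].
    exact.
  apply: (birkhoff_nonisolated hK hu hc gc Xm p0 ppx).
    by move=> e; exact: least_period_evper.
  move=> M; apply: contrapT => H; apply: nix; exists M => z xz.
  by apply: contrapT => zx; apply: H; exists z.
have xpi : per_iso x by split=> //; exists p.
have [n rn] := rep_iter x.
set r := rep x in rn.
have rr : rep r = r by rewrite rn (rep_periodic _ p0 ppx) -rn.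
have rp : least_period p r by rewrite rn; exact: least_period_iter.
have rpi : per_iso r by rewrite rn; exact: per_iso_iter.
have [rd /(_ p rp)[pos rdvd]] := dP r rpi.
(* With the period started at [r], only the first summand is corrected: the orbit has no other
   special point, and [r] does not recur before time [p]. *)
have -> : birkhoff c p x = birkhoff c0 p r + d r.
  rewrite -(birkhoff_rotate c n ppx) -rn.
  case: p p0 rp {px ppx pmin pos rdvd} => // p _ [_ pr rmin].
  rewrite /birkhoff !big_ord_recl /= /c asboolT//.
  rewrite -!addrA; congr (_ + _); rewrite addrC; congr (_ + _).
  apply: eq_bigr => i _; rewrite -/(c _) -iterS; apply: ccN => -[_].
  rewrite (rep_periodic _ _ pr)// rr => ri.
  by have := rmin (bump 0 i) isT (esym ri); have := ltn_ord i; rewrite /bump/=; lia.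
split=> // e xe; apply: rdvd.
have xE : iter (n * p - n) sh r = x by rewrite rn -iterD subnK ?iter_periodM//; nia.
by apply: (evper_image_iter (n := (n * p - n)%N) hc); rewrite xE.
Qed.

End ExactCocycle.

(** * Uniform positivity of long sums *)

Section Positivity.
Variables (a : finType) (X : one_sided_shift a) (m : nat) (c : X -> int).
Local Notation sh := (@shift_map a X).
Hypotheses (Xm : memory X m) (cl : locally_const c).
Hypothesis c_pos : forall x p, least_period p x -> 0 < birkhoff c p x.

Lemma birkhoff_periodic_pos n x : (0 < n)%N -> iter n sh x = x -> 0 < birkhoff c n x.
Proof.
move=> n0 nx; have [p px] := least_period_ex n0 nx.
have pos := c_pos px; have [p0 ppx pmin] := px.
elim/ltn_ind: n n0 nx => n IH n0 nx; have pn := pmin n n0 nx.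
rewrite -(subnKC pn) birkhoffD ppx.
have [->|np] := eqVneq n p; first by rewrite subnn birkhoff0 addr0.
apply: addr_gt0 => //; apply: IH; [lia..|].
by rewrite -{1}ppx -iterD subnK.
Qed.

(* A long orbit segment revisits some word; cutting the loop out removes the
   positive weight of a periodic point. *)
Lemma birkhoff_pos : exists2 N, (0 < N)%N & forall x, 1 <= birkhoff c N x.
Proof.
have [M MP] := cl.
(* The longer memory makes [c] read the same letters after cutting or closing as in [x]. *)
have Xm1 : memory X (m + M).
  move=> z H; apply: Xm => i; have [x [j xj]] := H i.
  by exists x, j => t tm; apply: xj; lia.
have [V VP] := recurrent_word X (m + M).
have [C CP] : exists C, forall x, (absz (c x) <= C)%N.
  by apply: locally_const_bounded; exists M => x z /MP ->.
have low n x : - (n * C)%N%:Z <= birkhoff c n x.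
  elim: n => [|n IH]; first by rewrite birkhoff0.
  by rewrite birkhoffS; have := CP (iter n sh x); lia.
have agr n x z : agree (n + M) (letters x) (letters z) -> birkhoff c n x = birkhoff c n z.
  move=> xz; apply: eq_bigr => i _; apply: MP => t tM.
  by rewrite !letters_iter; apply: xz; have := ltn_ord i; lia.
(* Each loop removed has length at most [V] and weight at least 1, and a remainder of length at most
   [V] weighs at least [- V * C]. *)
suff claim n x : n%:Z - V%:Z <= V%:Z * (birkhoff c n x + (V * C)%N%:Z).
  exists (V * (V * C + 2)).+1 => // x; have := claim (V * (V * C + 2)).+1 x.
  by nia.
elim/ltn_ind: n x => n IH x.
have [i [j [/andP[ij jV] xij]]] := VP x.
have [nV|Vn] := leqP n V.
  by have := low n x; nia.
have [z zE] := cut_loop Xm1 (ltnW ij) xij.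
have [y yj /agr yE] : exists2 y, iter (j - i) sh y = y &
    agree (j - i + M) (letters (iter i sh x)) (letters y).
  have [y yj H] := close_loop Xm1 ij xij.
  by exists y => //; apply: agreeW H; lia.
have zx : birkhoff c i z = birkhoff c i x.
  apply: agr => s sM; rewrite zE; case: ifPn => // /negbTE si.
  have := xij (s - i)%N; rewrite !letters_iter.
  rewrite (_ : i + _ = s)%N 1?(_ : j + _ = s + (j - i))%N; [|lia..].
  by move=> ->//; lia.
have zj : iter i sh z = iter j sh x.
  apply: letters_inj; apply/funext => s; rewrite !letters_iter zE ifF.
    by congr letters; lia.
  by apply/negbTE; lia.
have pos : 0 < birkhoff c (j - i) y by apply: birkhoff_periodic_pos => //; lia.
have := IH (n - (j - i))%N _ z; rewrite (_ : n - (j - i) = i + (n - j))%N; last lia.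
rewrite birkhoffD zx zj.
rewrite [in X in _ -> X](_ : n = i + ((j - i) + (n - j)))%N; last lia.
rewrite birkhoffD birkhoffD -iterD subnK ?(ltnW ij)// yE.
by nia.
Qed.

End Positivity.

(** * Two-sided points *)

Lemma int_step_ind (P : int -> Prop) :
  P 0 -> (forall n, P n <-> P (n + 1)) -> forall n, P n.
Proof.
move=> P0 PS; elim/int_rect => // n Pn.
  by have := (PS n).1 Pn; rewrite (_ : n%:Z + 1 = n.+1) //; lia.
by apply/PS; rewrite (_ : - n.+1%:Z + 1 = - n%:Z) //; lia.
Qed.

(* The signed sum of [f] over the interval between 0 and [n]. *)
Definition isum (f : int -> int) (n : int) : int :=
  match n with
  | Posz k => \sum_(i < k) f i%:Z
  | Negz k => - \sum_(i < k.+1) f (- i.+1%:Z)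
  end.

Lemma isum0 f : isum f 0 = 0.
Proof. by rewrite /= big_ord0. Qed.

Lemma isumS f n : isum f (n + 1) = isum f n + f n.
Proof.
case: n => [k|[|k]].
- by rewrite (_ : k%:Z + 1 = k.+1) /= ?big_ord_recr//; lia.
- by rewrite /= big_ord0 big_ord_recr big_ord0 /= add0r addNr.
- rewrite (_ : Negz k.+1 + 1 = Negz k) /=; last lia.
  by rewrite [in RHS]big_ord_recr /= opprD -addrA -NegzE addNr addr0.
Qed.

Lemma isum_shift f k n : isum (fun i => f (i + k)) n = isum f (n + k) - isum f k.
Proof.
elim/int_step_ind: n => [|n]; first by rewrite isum0 add0r subrr.
by rewrite isumS (_ : n + 1 + k = (n + k) + 1) ?isumS; [split|]; lia.
Qed.

Section Tails.
Variables (a : finType) (X : one_sided_shift a).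
Local Notation sh := (@shift_map a X).
Implicit Type x : two_sided X.

Definition zletters x : int -> a := \val x.

Lemma zletters_inj : injective zletters.
Proof. exact: val_inj. Qed.

Lemma zletters_shift k x i : zletters (zshift_map k x) i = zletters x (i + k).
Proof. by []. Qed.

Lemma zshift_map0 x : zshift_map 0 x = x.
Proof. by apply: zletters_inj; exact: zshift0. Qed.

Lemma zshift_mapD k n x : zshift_map (k + n) x = zshift_map k (zshift_map n x).
Proof. by apply: zletters_inj; exact: zshiftD. Qed.

Lemma tail_mem x (n : int) :
  ((fun i : nat => \val x (n + i%:Z)) : full_shift nat a) \in (X : set _).
Proof. exact: (mem_set (set_mem (valP x) n)). Qed.

Definition tail x (n : int) : X := exist (fun z => z \in (X : set _)) _ (tail_mem x n).

Lemma letters_tail x n i : letters (tail x n) i = zletters x (n + i%:Z).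
Proof. by []. Qed.

Lemma tail_shift k x n : tail (zshift_map k x) n = tail x (n + k).
Proof.
apply: letters_inj; apply/funext => i.
by rewrite !letters_tail zletters_shift; congr zletters; lia.
Qed.

Lemma tailD x n k : tail x (n + k%:Z) = iter k sh (tail x n).
Proof.
apply: letters_inj; apply/funext => i.
by rewrite letters_iter !letters_tail; congr zletters; lia.
Qed.

Lemma zshift_periodM x p (k : int) : zshift_map p x = x -> zshift_map (k * p) x = x.
Proof.
move=> px; elim/int_step_ind: k => [|k]; first by rewrite mul0r zshift_map0.
by rewrite mulrDl mul1r zshift_mapD px.
Qed.

Variable c : X -> int.

(** The position of [h (tail x n)] in the two-sided image, with [h (tail x 0)] placed at 0. *)
Definition csum x n := isum (fun i => c (tail x i)) n.

Lemma csum0 x : csum x 0 = 0. Proof. exact: isum0. Qed.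

Lemma csum_shift k x n : csum (zshift_map k x) n = csum x (n + k) - csum x k.
Proof.
rewrite /csum -isum_shift; congr isum.
by apply/funext => i; rewrite tail_shift.
Qed.

Lemma csumD x n k : csum x (n + k%:Z) = csum x n + birkhoff c k (tail x n).
Proof.
elim: k => [|k IH]; first by rewrite birkhoff0 !addr0.
rewrite (_ : n + k.+1%:Z = n + k%:Z + 1); last lia.
by rewrite /csum isumS -/(csum _ _) IH birkhoffS tailD addrA.
Qed.

Lemma csum_periodM x p (k : int) : zshift_map p x = x -> csum x (k * p) = k * csum x p.
Proof.
move=> px; elim/int_step_ind: k => [|k]; first by rewrite !mul0r csum0.
have := csum_shift p x (k * p); rewrite px !mulrDl !mul1r => ->.
by split=> [/eqP|->]; [rewrite subr_eq => /eqP|rewrite addrK].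
Qed.

End Tails.

(* If the shift [s] cannot be chosen uniformly, comparing two of its values makes
   both sequences periodic. *)
Lemma eventually_conjugate (T : Type) (u v : int -> T) (B : int) :
  (forall n, exists s, forall r, n + B <= r -> u r = v (r + s)) ->
  (forall n, exists s, forall r, n + B <= r -> v r = u (r + s)) ->
  exists s, forall r, u r = v (r + s).
Proof.
move=> uv vu.
have perM (w : int -> T) n (d k : nat) r : (forall r, n <= r -> w (r + d%:Z) = w r) ->
    n <= r -> w (r + (k * d)%N%:Z) = w r.
  move=> wd nr; elim: k => [|k IH]; first by rewrite mul0n addr0.
  rewrite (_ : r + _ = (r + (k * d)%N%:Z) + d); last lia.
  by rewrite wd ?IH//; lia.
(* If [u] is periodic, so is [v], and a shift valid far to the right is valid everywhere. *)
have uper (p : nat) : (0 < p)%N -> (forall r, u (r + p%:Z) = u r) ->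
    exists s, forall r, u r = v (r + s).
  move=> p0 up.
  have vp r : v (r + p%:Z) = v r.
    have [s sP] := vu (r - B).
    by rewrite !sP; [|lia..]; rewrite (_ : r + p%:Z + s = r + s + p%:Z) ?up//; lia.
  have [s sP] := uv 0; exists s => r.
  pose k := (absz r + absz B)%N.
  rewrite -(perM u r p k) => [|? _|]; [|exact: up|lia].
  rewrite -(perM v (r + s) p k) => [|? _|]; [|exact: vp|lia].
  by rewrite sP; [congr v|]; nia.
apply: contrapT => nuv.
have per n : exists d : nat, (0 < d)%N /\ forall r, n + B <= r -> u (r + d%:Z) = u r.
  have [s sP] := uv n.
  have [r0 r0P] : exists r, u r <> v (r + s).
    apply: contrapT => H; apply: nuv; exists s => r; apply: contrapT => urs.
    by apply: H; exists r.
  (* A shift [s2] valid at [r0] differs from [s]; where both are valid, [u] has period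
     [|s2 - s|]. *)
  pose n2 := Order.min n (r0 - B).
  have [s2 s2P] := uv n2.
  have ss2 : s2 <> s by move=> e; apply: r0P; rewrite -e s2P//; lia.
  exists (absz (s2 - s)); split; first lia.
  move=> r rn; have [lss|lss] : s < s2 \/ s2 < s by lia.
    rewrite sP; last lia.
    by rewrite s2P; [congr v|]; lia.
  rewrite s2P; last lia.
  by rewrite sP; [congr v|]; lia.
have [p [p0 pP]] := per 0.
apply: nuv; apply: (uper p p0) => r.
(* A period [d] valid from [r] on carries the comparison to the right, where the period [p] is
   known. *)
have [d [d0 dP]] := per (r - B).
pose k := (absz r + absz B)%N.
rewrite -(perM u r d k (r + p%:Z)); [|by move=> r' ?; apply: dP; lia|lia].
rewrite -[RHS](perM u r d k); [|by move=> r' ?; apply: dP; lia|lia].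
by rewrite -[RHS]pP; [congr u|]; nia.
Qed.

Lemma full_shift_continuous (T : topologicalType) (I : choiceType) (a : finType)
    (f : T -> full_shift I a) :
  (forall i, continuous (fun t => f t i : discrete_topology a)) -> continuous f.
Proof.
move=> fc t; apply/cvg_sup => i.
exact: (@continuous_comp_initial _ _ _ (fun u : full_shift I a => u i) f (fc i)).
Qed.

Lemma set_type_continuous (T S : topologicalType) (A : set S) (f : T -> A) :
  continuous (fun t => \val (f t) : S) -> continuous f.
Proof. exact: (@continuous_comp_initial _ _ _ (set_val : A -> S) f). Qed.

(** * Topology of the two-sided shift space *)

Section Topology.
Variables (a : finType) (X : one_sided_shift a).

Lemma two_sided_closed : closed (two_sided X).
Proof.
pose f (m : int) (x : full_shift int a) : full_shift nat a := fun n => x (m + n%:Z).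
have fc m : continuous (f m).
  apply: full_shift_continuous => n x; exact: (@proj_continuous _ _ (m + n%:Z) x).
have -> : two_sided X = \bigcap_(m in [set: int]) (f m @^-1` (shift_points X)).
  by apply/seteqP; split=> x xX m => [_|]; exact: xX.
apply: closed_bigI => m _; have /continuous_closedP := fc m; apply.
exact: shift_points_closed.
Qed.

Lemma absz_finite M : exists s : seq int, forall i, (absz i < M)%N -> i \in s.
Proof.
exists ([seq i%:Z | i <- iota 0 M] ++ [seq - i%:Z | i <- iota 0 M]) => i iM.
rewrite mem_cat; case: (intP i) iM => [|n|n] iM; apply/orP.
- by left; apply/mapP; exists 0%N => //; rewrite mem_iota; lia.
- by left; apply/mapP; exists n.+1 => //; rewrite mem_iota; lia.
- by right; apply/mapP; exists n.+1 => //; rewrite mem_iota; lia.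
Qed.

(** The shift is onto [X], so preimages can be chosen successively to extend [z] to the left. *)
Lemma two_sided_extension (z : X) : exists x : two_sided X, tail x 0 = z.
Proof.
have /choice[pre preK] : forall x : X, exists y, shift_map y = x.
  move=> x; have := set_valP x; rewrite -{1}(shift_points_onto X) => -[y Xy yx].
  exists (exist (fun z => z \in (X : set _)) y (mem_set Xy)).
  exact: letters_inj.
have preKn k x : iter k (@shift_map _ X) (iter k pre x) = x.
  by elim: k x => // k IH x; rewrite iterSr iterS preK IH.
pose w (i : int) : a := match i with
  | Posz k => letters z k | Negz k => letters (iter k.+1 pre z) 0 end.
have wE (m : int) i : w (m + i%:Z) = letters
    (match m with Posz k => iter k (@shift_map _ X) z | Negz k => iter k.+1 pre z end) i.
  case: m => k; first by rewrite letters_iter.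
  have [ki|ik] := leqP k.+1 i.
    rewrite (_ : Negz k + i%:Z = (i - k.+1)%N) /w; last lia.
    by rewrite -{1}(preKn k.+1 z) letters_iter subnKC.
  rewrite (_ : Negz k + i%:Z = Negz (k - i)) /w; last lia.
  rewrite (_ : k.+1 = i + (k - i).+1)%N; last lia.
  rewrite iterD -[in RHS](addn0 i) -letters_iter; congr letters.
  by rewrite -iterD addn0 iterD preKn.
have wX : (w : full_shift int a) \in two_sided X.
  apply/mem_set => m; rewrite (_ : (fun n => _) = letters
    (match m with Posz k => iter k (@shift_map _ X) z | Negz k => iter k.+1 pre z end)).
    exact: set_valP.
  by apply/funext => i; exact: wE.
exists (exist (fun z => z \in two_sided X) _ wX).
by apply: letters_inj; apply/funext => i; exact: (wE 0).
Qed.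

Lemma two_sided_compact : compact [set: two_sided X].
Proof. exact: closed_compact_setT two_sided_closed. Qed.

Lemma two_sided_continuous (T : topologicalType) (f : T -> two_sided X) :
  (forall t i, nbhs t [set t' | zletters (f t') i = zletters (f t) i]) -> continuous f.
Proof.
move=> fP; apply: set_type_continuous; apply: full_shift_continuous => i t U.
move/principal_filterP => Ut.
by apply: filterS (fP t i) => t' /= e; rewrite -[X in U X]/(zletters (f t') i) e.
Qed.

Lemma zshift_map_continuous n : continuous (@zshift_map _ X n).
Proof.
apply: two_sided_continuous => x i.
have := cylinder_nbhs absz_finite x (absz (i + n)).+1; apply: filterS => z /= xz.
by rewrite !zletters_shift; apply/esym/xz.
Qed.

Lemma two_sided_hausdorff : hausdorff_space (two_sided X).
Proof.
move=> x y xy; apply: zletters_inj; apply/funext => i.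
have [z [xz yz]] := xy _ _ (cylinder_nbhs absz_finite x (absz i).+1)
  (cylinder_nbhs absz_finite y (absz i).+1).
by apply: etrans (xz i _) (esym (yz i _)).
Qed.

End Topology.

Lemma hausdorff_prod (S T : topologicalType) :
  hausdorff_space S -> hausdorff_space T -> hausdorff_space (S * T)%type.
Proof.
move=> hS hT [p1 p2] [q1 q2] pq; congr (_, _).
  apply: hS => U V pU qV.
  have [] := pq (U `*` setT) (V `*` setT).
  - by exists (U, setT) => //; split=> //; exact: filterT.
  - by exists (V, setT) => //; split=> //; exact: filterT.
  by move=> [z1 z2] [[/= zU _] [/= zV _]]; exists z1.
apply: hT => U V pU qV.
have [] := pq (setT `*` U) (setT `*` V).
- by exists (setT, U) => //; split=> //; exact: filterT.
- by exists (setT, V) => //; split=> //; exact: filterT.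
by move=> [z1 z2] [[/= _ zU] [/= _ zV]]; exists z2.
Qed.

(** * The lag cocycle of a continuous orbit equivalence *)

Section OrbitEquivalence.
Variables (a b : finType) (X : one_sided_shift a) (Y : one_sided_shift b).

Lemma continuous_locally_const (k : X -> nat) : continuous k -> locally_const k.
Proof.
move=> kc; apply: locally_constP => x.
by apply: (kc x [set n | n = k x]); apply/principal_filterP.
Qed.

Lemma continuous_uniform (h : X -> Y) : continuous h -> uniform_map h.
Proof.
move=> hc; elim=> [|K [M MP]]; first by exists 0%N => x z _ i.
have [M' M'P] : locally_const (fun x => letters (h x) K).
  apply: locally_constP => x.
  have := @continuous_comp _ _ _ h _ x (hc x) (@letter_continuous _ _ _ K (h x)).
  by move=> /(_ [set t | t = letters (h x) K]); apply; apply/principal_filterP.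
exists (M + M')%N => x z xz i; rewrite ltnS leq_eqVlt => /orP[/eqP->|iK].
  by apply: M'P; apply: agreeW xz; lia.
by apply: MP => //; apply: agreeW xz; lia.
Qed.

Lemma orbit_cocycle (h : X -> Y) (k l : X -> nat) : continuous k -> continuous l ->
  (forall x, iter (k x) (@shift_map _ Y) (h (shift_map x)) =
             iter (l x) (@shift_map _ Y) (h x)) ->
  lag_cocycle h (fun x => (l x)%:Z - (k x)%:Z).
Proof.
move=> /continuous_locally_const kc /continuous_locally_const lc H; split.
  exact: (locally_const_comp2 (fun u v : nat => u%:Z - v%:Z) lc kc).
have [K KP] := locally_const_bounded kc.
have [L LP] := locally_const_bounded lc.
exists (K + L)%N => x i j iB jB ij; have := KP x; have := LP x => xL xK.
have := congr1 (fun z => letters z (j - k x)%N) (H x); rewrite !letters_iter.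
by rewrite subnKC; [move=> ->; congr letters|]; lia.
Qed.

End OrbitEquivalence.

(** * The induced map on two-sided points *)

Notation zagree := (agree_below absz).

Lemma csum_locally_const (a : finType) (X : one_sided_shift a) (c : X -> int) n :
  locally_const c -> exists M, forall x z : two_sided X,
  zagree M (zletters x) (zletters z) -> csum c x n = csum c z n.
Proof.
move=> [M MP].
have ct k : forall x z : two_sided X, zagree (M + absz k) (zletters x) (zletters z) ->
    c (tail x k) = c (tail z k).
  by move=> x z xz; apply: MP => i iM; rewrite !letters_tail; apply: xz; lia.
elim/int_step_ind: n => [|n]; first by exists 0%N => x z _; rewrite !csum0.
have E x : csum c x (n + 1) = csum c x n + c (tail x n) by exact: isumS.
split=> -[K KP]; exists (K + (M + absz n))%N => x z xz.
  rewrite !E (ct n x z); last by move=> i iM; apply: xz; lia.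
  by congr (_ + _); apply: KP => i iM; apply: xz; lia.
apply: (addIr (c (tail x n))); rewrite -E (ct n x z) -?E.
  by apply: KP => i iM; apply: xz; lia.
by move=> i iM; apply: xz; lia.
Qed.

Section Code.
Variables (a b : finType) (X : one_sided_shift a) (Y : one_sided_shift b).
Local Notation shX := (@shift_map a X).
Local Notation shY := (@shift_map b Y).
Variables (h : X -> Y) (g : Y -> X) (c : X -> int) (c' : Y -> int).
Hypotheses (hK : cancel h g) (gK : cancel g h).
Hypotheses (hu : uniform_map h) (gu : uniform_map g).
Hypotheses (hc : lag_cocycle h c) (gc : lag_cocycle g c').
Hypothesis (c_exact : period_exact h c).
Variables (N Bl Bc : nat).
Hypotheses (N0 : (0 < N)%N) (c_pos : forall x, 1 <= birkhoff c N x).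
Hypotheses (c_lag : forall x, lag Bl (c x) (letters (h x)) (letters (h (shX x)))).
Hypotheses (c_bound : forall x, (absz (c x) <= Bc)%N).
Local Notation csum := (csum c).
Implicit Type x : two_sided X.

Lemma birkhoff_lower k (x : X) : - (N * Bc)%N%:Z <= birkhoff c k x.
Proof.
have rem r z : (r <= N)%N -> - (N * Bc)%N%:Z <= birkhoff c r z.
  move=> rN; suff : - (r * Bc)%N%:Z <= birkhoff c r z by nia.
  elim: r {rN} => [|r IH]; first by rewrite birkhoff0.
  by rewrite birkhoffS; have := c_bound (iter r shX z); lia.
have full q z : q%:Z <= birkhoff c (q * N) z.
  elim: q z => [|q IH] z; first by rewrite birkhoff0.
  by rewrite mulSn birkhoffD; have := IH (iter N shX z); have := c_pos z; lia.
rewrite [in X in _ <= X](divn_eq k N) birkhoffD.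
have := rem _ (iter (k %/ N * N) shX x) (ltnW (ltn_pmod k N0)).
have := full (k %/ N)%N x; move: (k %/ N)%N => q; lia.
Qed.

Lemma csum_lower x n k : csum x n - (N * Bc)%N%:Z <= csum x (n + k%:Z).
Proof. by rewrite csumD; have := birkhoff_lower k (tail x n); lia. Qed.

Lemma csum_linear x n k : csum x n + k%:Z <= csum x (n + (k * N)%N%:Z).
Proof.
rewrite csumD; elim: k n => [|k IH] n; first by rewrite mul0n birkhoff0.
have := IH (n + N%:Z); rewrite mulSn birkhoffD -tailD; have := c_pos (tail x n); lia.
Qed.

(** The sums never drop by more than [N * Bc], and the lags hold from [Bl] on. *)
Definition margin : nat := (N * Bc + Bl)%N.

(** No intermediate sum exceeds the last one by more than [N * Bc], so [p] stays at least [Bl] to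
    the right of every placed point and the one-step lag applies each time. *)
Lemma tail_image_agree x n k (p : int) : csum x (n + k%:Z) + margin%:Z <= p ->
  letters (h (tail x n)) (absz (p - csum x n)) =
  letters (h (tail x (n + k%:Z))) (absz (p - csum x (n + k%:Z))).
Proof.
elim: k n => [|k IH] n; first by rewrite addr0.
rewrite (_ : n + k.+1%:Z = n + 1 + k%:Z); last lia.
move=> H; rewrite -IH//.
have l1 := csum_lower x n k.+1; have l2 := csum_lower x (n + 1) k.
move: l1; rewrite (_ : n + k.+1%:Z = n + 1 + k%:Z); last lia.
move=> l1; have -> : tail x (n + 1) = shX (tail x n) by exact: tailD x n 1.
have e : csum x (n + 1) = csum x n + c (tail x n).
  by rewrite (csumD c x n 1) birkhoffS birkhoff0 add0r.
by move: H; rewrite /margin => H; apply: c_lag; lia.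
Qed.

(* A starting index far enough to the left, chosen independently of the point. *)
Definition base (p : int) : int := - ((absz p + margin) * N)%N%:Z.

Lemma base_lower x p : csum x (base p) + margin%:Z <= p.
Proof.
have := csum_linear x (base p) (absz p + margin).
by rewrite /base addNr csum0; lia.
Qed.

Definition code_letters x (p : int) : b :=
  letters (h (tail x (base p))) (absz (p - csum x (base p))).

Lemma code_lettersE x n p : csum x n + margin%:Z <= p ->
  code_letters x p = letters (h (tail x n)) (absz (p - csum x n)).
Proof.
move=> np; have bp := base_lower x p; rewrite /code_letters.
have [le_bn|le_nb] : base p <= n \/ n <= base p by lia.
  have [k kE] : exists k : nat, n = base p + k%:Z by exists (absz (n - base p)); lia.
  by rewrite kE in np *; exact: tail_image_agree.
have [k kE] : exists k : nat, base p = n + k%:Z by exists (absz (n - base p)); lia.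
by rewrite kE in bp *; rewrite -tail_image_agree.
Qed.

Lemma code_mem x : (code_letters x : full_shift int b) \in two_sided Y.
Proof.
apply/mem_set => k; have bk := base_lower x k; set n := base k in bk.
have -> : (fun i : nat => code_letters x (k + i%:Z)) =
    letters (iter (absz (k - csum x n)) shY (h (tail x n))).
  apply/funext => i; rewrite letters_iter (@code_lettersE _ n); last lia.
  by congr letters; lia.
exact: set_valP.
Qed.

Definition code x : two_sided Y :=
  exist (fun z => z \in two_sided Y) _ (code_mem x).

Lemma zletters_code x : zletters (code x) = code_letters x.
Proof. by []. Qed.

Lemma code_shift k x : code (zshift_map k x) = zshift_map (csum x k) (code x).
Proof.
apply: zletters_inj; apply/funext => p; rewrite zletters_shift !zletters_code.
set n := base p; have := base_lower (zshift_map k x) p; rewrite -/n => np.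
rewrite (code_lettersE np) tail_shift; move: np; rewrite csum_shift => np.
by rewrite (@code_lettersE x (n + k)); [congr letters|]; lia.
Qed.

Lemma code_locally_const p : exists M, forall x z,
  zagree M (zletters x) (zletters z) -> zletters (code x) p = zletters (code z) p.
Proof.
have [M MP] := csum_locally_const (base p) hc.1.
have [C CP] : exists C, forall x, (absz (csum x (base p)) <= C)%N.
  set K := ((absz p + margin) * N)%N; have [C CP] := birkhoff_bound hc K.
  exists C => x; have := csumD c x (base p) K; rewrite /base addNr csum0.
  by rewrite -/(base p); have := CP (tail x (base p)); lia.
have [K KP] := hu (absz p + C + 1).
exists (M + (K + absz (base p)))%N => x z xz.
rewrite !zletters_code /code_letters -(MP x z); last by move=> i iM; apply: xz; lia.
apply: KP => [i iK|]; last by have := CP x; lia.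
by rewrite !letters_tail; apply: xz; lia.
Qed.

(** From a start below [t], blocks of [N] steps raise the sum by between 1 and [N * Bc]; the last
    value not above [t] is close enough. *)
Lemma csum_hits x t : exists n, (absz (csum x n - t) <= N * Bc)%N.
Proof.
pose n0 := base t; have lo := base_lower x t; rewrite -/n0 in lo.
pose f k := csum x (n0 + (k * N)%N%:Z).
have ex : exists k, f k <= t by exists 0%N; rewrite /f mul0n addr0; lia.
have ub k : f k <= t -> (k <= absz (t - csum x n0))%N.
  by move=> fk; have := csum_linear x n0 k; rewrite -/(f k); lia.
case: (ex_maxnP ex ub) => k fk kmax.
exists (n0 + (k * N)%N%:Z); rewrite -/(f k).
have : ~ f k.+1 <= t by move=> /kmax; lia.
have -> : f k.+1 = f k + birkhoff c N (tail x (n0 + (k * N)%N%:Z)).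
  by rewrite /f -csumD; congr csum; lia.
have : birkhoff c N (tail x (n0 + (k * N)%N%:Z)) <= (N * Bc)%N%:Z.
  move: (tail _ _) => z; elim: N => [|r IH]; first by rewrite birkhoff0.
  by rewrite birkhoffS; have := c_bound (iter r shX z); lia.
by lia.
Qed.

Lemma lag_transport B E : exists B', forall z z' d, (absz d <= E)%N ->
  lag B d (letters (h z)) (letters (h z')) ->
  exists2 d', lag B' d' (letters z) (letters z') & (absz d' <= B')%N.
Proof.
have [C CP] := birkhoff_lag_le gc (B + 2 * E).
exists (4 * C)%N => z z' d dE lz.
pose K := absz ((B + E)%N%:Z + d); pose L := (B + E)%N.
have e : iter K shY (h z) = iter L shY (h z').
  by apply: letters_inj; apply/funext => i; rewrite !letters_iter; apply: lz; lia.
have [|l1 b1] := CP K (h z); first lia.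
have [|l2 b2] := CP L (h z'); first lia.
exists (birkhoff c' K (h z) - birkhoff c' L (h z')); last lia.
rewrite e !hK in l1; rewrite hK in l2.
by apply: lag_le (lag_trans l1 (lag_sym l2)); lia.
Qed.

(** Tails of [x] and [x'] placed at nearly the same position have images with a bounded lag, which
    [g] transports back with a uniform threshold. *)
Lemma code_tails x x' j : code x = zshift_map j (code x') ->
  exists B : nat, forall n, exists s, forall r, n + B%:Z <= r ->
    zletters x r = zletters x' (r + s).
Proof.
move=> xx'; have [B BP] := lag_transport margin (N * Bc).
exists (2 * B)%N => n; have [n' n'P] := csum_hits x' (csum x n + j).
pose d := csum x' n' - csum x n - j.
have cE p : code_letters x p = code_letters x' (p + j).
  by rewrite -!zletters_code xx' zletters_shift.
have [||d' ld d'B] := BP (tail x n) (tail x' n') d; first lia.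
  move=> i i' iB i'B ii'.
  have := cE (csum x n + i%:Z); rewrite (@code_lettersE _ n); last lia.
  rewrite (@code_lettersE _ n'); last lia.
  have -> : absz (csum x n + i%:Z - csum x n)%R = i by lia.
  by have -> : absz (csum x n + i%:Z + j - csum x' n')%R = i' by lia.
exists (n' - n - d') => r nr.
have := ld (absz (r - n)%R) (absz (r - n - d')%R); rewrite !letters_tail.
move=> /(_ ltac:(lia) ltac:(lia) ltac:(lia)).
have -> : n + (absz (r - n)%R)%:Z = r by lia.
by have -> : n' + (absz (r - n - d')%R)%:Z = r + (n' - n - d') by lia.
Qed.

Lemma code_orbit x x' j : code x = zshift_map j (code x') ->
  exists n, x = zshift_map n x'.
Proof.
move=> xx'.
have x'x : code x' = zshift_map (- j) (code x).
  by rewrite xx' -zshift_mapD addNr zshift_map0.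
have [B BP] := code_tails xx'; have [B' B'P] := code_tails x'x.
have [n|n|s sP] := @eventually_conjugate _ (zletters x) (zletters x') (B + B')%N%:Z.
- by have [s sP] := BP n; exists s => r nr; apply: sP; lia.
- by have [s sP] := B'P n; exists s => r nr; apply: sP; lia.
by exists s; apply: zletters_inj; apply/funext => r; rewrite sP.
Qed.

(* The points [h (tail x n)] have period [j] after a uniformly bounded prefix, so
   they are finitely many and [x] is periodic. *)
Lemma code_self x j : code x = zshift_map j (code x) ->
  exists n, zshift_map n x = x /\ csum x n = j.
Proof.
move=> xj; have [->|j0] := eqVneq j 0.
  by exists 0; rewrite zshift_map0 csum0.
have self n : lag margin j (letters (h (tail x n))) (letters (h (tail x n))).
  move=> i i' iB i'B ii'.
  have E k : (margin <= k)%N -> letters (h (tail x n)) k = code_letters x (csum x n + k%:Z).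
    by move=> kB; rewrite (@code_lettersE _ n); [congr letters|]; lia.
  rewrite !E// -[RHS]/(zletters (code x) _) -[LHS]/(zletters (code x) _).
  by rewrite [in RHS]xj zletters_shift; congr zletters; lia.
have [V VP] := pigeonhole_agree b (margin + absz j).
have tail_per n : exists2 p, (0 < p)%N & iter p shX (tail x n) = tail x n.
  have [i [k [/andP[ik kV] agr]]] := VP (fun i => letters (h (tail x (n - V%:Z + i%:Z)))).
  have /letters_inj/(can_inj hK) e := self_lag_inj j0 (self _) (self _) agr.
  exists (k - i)%N; first lia.
  have -> : tail x n = iter (V - i) shX (tail x (n - V%:Z + i%:Z)).
    by rewrite -tailD; congr tail; lia.
  rewrite -iterD addnC iterD -(tailD _ _ (k - i)).
  by rewrite (_ : n - V%:Z + i%:Z + (k - i)%N%:Z = n - V%:Z + k%:Z) -?e//; lia.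
have [p1 p10 p1x] := tail_per 0; have [p px] := least_period_ex p10 p1x.
have [p0 ppx pmin] := px.
(* Left of 0 the least period is still [p], because [tail x 0] is an iterate of the periodic point
   [tail x n]. *)
have pn n : iter p shX (tail x n) = tail x n.
  have [n0|n0] : 0 <= n \/ n < 0 by lia.
    rewrite (_ : n = 0 + (absz n)%:Z) ?tailD ?iter_periodC//; lia.
  have [q1 q10 q1x] := tail_per n; have [q qx] := least_period_ex q10 q1x.
  have := least_period_iter (absz n) qx; rewrite -tailD (_ : n + _ = 0); last lia.
  case=> q0 qqx qmin; have -> : p = q by apply/eqP; rewrite eqn_leq pmin// qmin.
  by case: qx.
have zp : zshift_map p%:Z x = x.
  apply: zletters_inj; apply/funext => r; rewrite zletters_shift.
  by have := congr1 (fun z => letters z 0) (pn r); rewrite letters_iter !letters_tail addn0 addr0.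
(* By exactness [j] is a multiple [k] of the sum over one period, so [k] periods have sum [j]. *)
have [pos pdvd] := c_exact px.
have /pdvd/dvdzP[k kE] : evper (letters (h (tail x 0))) j by exists margin.
exists (k * p); rewrite zshift_periodM// csum_periodM//; split=> //.
by rewrite -[p%:Z]add0r csumD csum0 add0r.
Qed.

(** The shift given by [code_orbit] may have the wrong sum; the discrepancy is a self-shift of
    [code x'], which a period of [x'] realises. *)
Lemma code_eq x x' j : code x = zshift_map j (code x') ->
  exists n, x = zshift_map n x' /\ csum x' n = j.
Proof.
move=> xx'; have [n xn] := code_orbit xx'; rewrite xn code_shift in xx' *.
have [|n1 [n1x n1j]] := @code_self x' (j - csum x' n).
  by rewrite addrC zshift_mapD -xx' -zshift_mapD addNr zshift_map0.
exists (n + n1); rewrite zshift_mapD n1x; split=> //.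
by have := csum_shift c n1 x' n; rewrite n1x n1j; lia.
Qed.

Lemma code_continuous : continuous code.
Proof.
apply: two_sided_continuous => x i; have [M MP] := code_locally_const i.
have := cylinder_nbhs absz_finite x M; apply: filterS => z xz.
by apply/esym/MP.
Qed.

Lemma code_locally_uniform K : exists M, forall x z,
  zagree M (zletters x) (zletters z) -> zagree K (zletters (code x)) (zletters (code z)).
Proof.
elim: K => [|K [M MP]]; first by exists 0%N.
have [M1 M1P] := code_locally_const K%:Z; have [M2 M2P] := code_locally_const (- K%:Z).
exists (M + M1 + M2)%N => x z xz i iK.
have [iK'|iK'] := ltnP (absz i) K; first by apply: MP iK' => j jM; apply: xz; lia.
have [->|->] : i = K%:Z \/ i = - K%:Z by lia.
  by apply: M1P => j jM; apply: xz; lia.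
by apply: M2P => j jM; apply: xz; lia.
Qed.

Lemma code_approx (y : two_sided Y) M : exists x d, (absz d <= N * Bc)%N /\
  zagree M (zletters y) (zletters (zshift_map d (code x))).
Proof.
(* [m] leaves room for the window and for [margin]. Moving by [n] recentres the window up to an
   error bounded independently of [M], as the compactness argument for surjectivity requires. *)
pose m : int := - (M + margin)%N%:Z.
have [w wE] := two_sided_extension (g (tail y m)).
have [n nP] := csum_hits w (- m).
exists (zshift_map n w), (- (csum w n + m)); split; first lia.
move=> p pM; rewrite zletters_shift code_shift zletters_shift zletters_code.
rewrite (@code_lettersE w 0); last by rewrite csum0; lia.
by rewrite wE gK letters_tail csum0; congr zletters; lia.
Qed.

(** The approximants have a cluster point [x], and only finitely many displacements occur. If each
    failed for [x] at some coordinate, an approximant close to [x] and accurate at these coordinates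
    would give a contradiction. *)
Lemma code_surj (y : two_sided Y) : exists x j, y = zshift_map j (code x).
Proof.
have /choice[u uP] : forall M, exists xd : two_sided X * int, (absz xd.2 <= N * Bc)%N /\
    zagree M (zletters y) (zletters (zshift_map xd.2 (code xd.1))).
  by move=> M; have [x [d ?]] := code_approx y M; exists (x, d).
have [] := @two_sided_compact _ X ((fun M => (u M).1) @ \oo); first exact: filterT.
move=> x [_ clx]; apply: contrapT => nx.
have /choice[r rP] : forall d : int, exists r,
    zletters y r <> zletters (zshift_map d (code x)) r.
  move=> d; apply: contrapT => H; apply: nx; exists x, d.
  apply: zletters_inj; apply/funext => r; apply: contrapT => yr.
  by apply: H; exists r.
pose E := (N * Bc)%N.
pose K := (\max_(i < (2 * E).+1) (absz (r (i%:Z - E%:Z)%R))).+1.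
have rK d : (absz d <= E)%N -> (absz (r d) < K)%N.
  move=> dE; have iE : (absz (d + E%:Z)%R < (2 * E).+1)%N by lia.
  rewrite /K ltnS; apply: leq_trans (leq_bigmax (Ordinal iE)).
  by rewrite /= (_ : (absz (d + E%:Z)%R)%:Z - E%:Z = d) //; lia.
have [M MP] := code_locally_uniform (K + E).
have [] := clx [set (u n).1 | n in [set n | (K <= n)%N]] _ _ (cylinder_nbhs absz_finite x M).
  by exists K => // n /= Kn; exists n.
move=> _ [[n /= Kn <-] /MP xn]; have [dE yu] := uP n.
apply: (rP (u n).2); rewrite yu; last by have := rK _ dE; lia.
by rewrite !zletters_shift; apply/esym/xn; have := rK _ dE; lia.
Qed.

End Code.

(** * The flow on suspensions *)

Section PiecewiseLinear.
Variable R : realType.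
Implicit Types (A : int -> R) (t r s : R).

Definition pl A t : R :=
  let n := Num.floor t in A n + (t - n%:~R) * (A (n + 1) - A n).

Lemma pl_shift A k t : pl (fun n => A (n + k)) t = pl A (t + k%:~R).
Proof.
rewrite /pl floorDrz ?intr_int// intrKfloor rmorphD/= addrAC.
by congr (_ + _ * _); ring.
Qed.

Lemma pl_addc A e t : pl (fun n => A n + e) t = pl A t + e.
Proof. by rewrite /pl; ring. Qed.

Lemma pl_int A n : pl A n%:~R = A n.
Proof. by rewrite /pl intrKfloor subrr mul0r addr0. Qed.

Section Bilipschitz.
Variables (A : int -> R) (s S : R).
Hypotheses (s0 : 0 < s) (As : forall n, s <= A (n + 1) - A n <= S).

Lemma slope_iter n (k : nat) : s *+ k <= A (n + k%:Z) - A n <= S *+ k.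
Proof.
elim: k => [|k /andP[IH1 IH2]]; first by rewrite addr0 subrr !mulr0n lexx.
have /andP[h1 h2] := As (n + k%:Z).
rewrite (_ : n + k.+1%:Z = n + k%:Z + 1); last lia.
by rewrite !mulrSr; apply/andP; split; lra.
Qed.

Lemma pl_bilipschitz t t' : t <= t' ->
  s * (t' - t) <= pl A t' - pl A t <= S * (t' - t).
Proof.
move=> tt'; rewrite /pl; set n := Num.floor t; set n' := Num.floor t'.
have nn' : n <= n' by exact: le_floor.
have /andP[n1 n2] : n%:~R <= t < (n + 1)%:~R by exact: floor_itv.
have /andP[n'1 n'2] : n'%:~R <= t' < (n' + 1)%:~R by exact: floor_itv.
have /andP[s1 s2] := As n; have /andP[s1' s2'] := As n'.
(* Within one unit interval the map is affine; otherwise the increment splits into two end pieces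
   and an integral middle part. *)
have [e|lt] : n' = n \/ n + 1 <= n' by lia.
  rewrite e; move: (A (n + 1)) (A n) s1 s2 => u v s1 s2.
  by apply/andP; split; nra.
have kE : n' = n + 1 + (absz (n' - (n + 1))%R)%:Z by lia.
have /andP[k1 k2] := slope_iter (n + 1) (absz (n' - (n + 1))%R).
rewrite -kE in k1 k2; move: k1 k2.
rewrite -(mulr_natr s) -(mulr_natr S).
have -> : (absz (n' - (n + 1))%R)%:R = n'%:~R - (n%:~R + 1) :> R.
  by rewrite natr_absz ger0_norm ?rmorphB/= ?rmorphD//; lia.
move: n2 n'2; rewrite !rmorphD/= => n2 n'2.
move: (A (n + 1)) (A n) (A (n' + 1)) (A n') s1 s2 s1' s2' => u v u' v' s1 s2 s1' s2' k1 k2.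
have a1 : s * (t' - n'%:~R) <= (t' - n'%:~R) * (u' - v') <= S * (t' - n'%:~R).
  by apply/andP; split; nra.
have a2 : s * (n%:~R + 1 - t) <= (n%:~R + 1 - t) * (u - v) <= S * (n%:~R + 1 - t).
  by apply/andP; split; nra.
by move: a1 a2 => /andP[? ?] /andP[? ?]; apply/andP; split; nra.
Qed.

Lemma pl_lt t t' : t < t' -> pl A t < pl A t'.
Proof.
move=> tt'; have /andP[+ _] := pl_bilipschitz (ltW tt').
by move=> h; rewrite -subr_gt0; apply: lt_le_trans h; rewrite mulr_gt0// subr_gt0.
Qed.

Lemma pl_inj : injective (pl A).
Proof.
move=> t t' e; have [/pl_lt|/pl_lt|//] := ltgtP t t'.
  by rewrite e ltxx.
by rewrite e ltxx.
Qed.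

Lemma pl_lipschitz t t' : `|pl A t - pl A t'| <= S * `|t - t'|.
Proof.
wlog tt' : t t' / t <= t'.
  move=> H; have [/H//|/ltW/H] := leP t t'.
  by rewrite distrC (distrC t').
have /andP[h1 h2] := pl_bilipschitz tt'.
rewrite distrC (distrC t) (ger0_norm (x := t' - t)) ?subr_ge0// ger0_norm//.
by apply: le_trans h1; rewrite mulr_ge0 ?subr_ge0// ltW.
Qed.

Lemma pl_surj r : exists t, pl A t = r.
Proof.
have S0 : 0 < S by have /andP[h1 h2] := As 0; exact: lt_le_trans s0 (le_trans h1 h2).
have plc : continuous (pl A).
  move=> t; apply/cvgrPdist_le => e e0; near=> t'.
  apply: le_trans (pl_lipschitz _ _) _.
  rewrite mulrC -ler_pdivlMr//; near: t'.
  by apply: (@cvgr_dist_le _ _ _ (nbhs t) _ id t) => //; rewrite divr_gt0.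
pose d := `|r - pl A 0| / s.
have d0 : 0 <= d by rewrite divr_ge0// ltW.
have sd : s * d = `|r - pl A 0| by rewrite /d mulrC divfK// gt_eqF.
have h1 : pl A (- d) <= r.
  have /andP[+ _] := @pl_bilipschitz (- d) 0 ltac:(lra).
  by have := ler_norm (- (r - pl A 0)); rewrite normrN; lra.
have h2 : r <= pl A d.
  have /andP[+ _] := @pl_bilipschitz 0 d d0.
  by have := ler_norm (r - pl A 0); lra.
have [|||t _ tr] := @IVT _ (pl A) (- d) d r; first lra.
- exact: continuous_subspaceT.
- by rewrite ge_min le_max h1 h2 orbT.
by exists t.
Unshelve. all: by end_near. Qed.

End Bilipschitz.
End PiecewiseLinear.

Local Open Scope quotient_scope.

(** * Equality of classes in the suspension *)

Section SuspensionClass.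
Variables (a : finType) (X : one_sided_shift a) (R : realType).
Implicit Types (x y : two_sided X) (t r : R).

(** The generating steps allow every integer [n], so they already form an equivalence relation. *)
Lemma suspension_class_eq x y t r :
  suspension_class x t = suspension_class y r <->
  exists n : int, x = zshift_map n y /\ r = t + n%:~R.
Proof.
split; last first.
  move=> [n [-> ->]]; apply/eqmodP/asboolP; apply: Relation_Operators.rst_step.
  by exists y, t, n.
move=> /eqmodP/asboolP H.
have : exists n : int, (x, t).1 = zshift_map n (y, r).1 /\ (y, r).2 = (x, t).2 + n%:~R.
  elim: H => [p q [z [u [n [-> ->]]]]|p|p q _ [n [pq qp]]|p q s _ [n [pq qp]] _ [k [qs sq]]].
  - by exists n.
  - by exists 0; rewrite zshift_map0 addr0.
  - exists (- n); rewrite pq -zshift_mapD addNr zshift_map0; split=> //.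
    by rewrite qp mulrNz addrK.
  exists (n + k); rewrite pq qs -zshift_mapD; split=> //.
  by rewrite sq qp rmorphD/= addrA.
by [].
Qed.

Lemma suspension_class_shift x y t r s :
  suspension_class x t = suspension_class y r ->
  suspension_class x (t + s) = suspension_class y (r + s).
Proof.
move=> /suspension_class_eq[n [xy rt]]; apply/suspension_class_eq.
by exists n; split=> //; rewrite rt addrAC.
Qed.

Lemma suspension_classP (q : suspension X R) : exists x t, q = suspension_class x t.
Proof.
exists (repr q).1, (repr q).2.
by rewrite /suspension_class -surjective_pairing reprK.
Qed.

Lemma suspension_class_unit x t : exists y r, 0 <= r <= 1 /\
  suspension_class x t = suspension_class y r.
Proof.
exists (zshift_map (Num.floor t) x), (t - (Num.floor t)%:~R); split.
  have /andP[h1 h2] := floor_itv t; move: h2; rewrite rmorphD/= => h2; apply/andP; split; lra.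
apply/esym/suspension_class_eq; exists (Num.floor t); split=> //; lra.
Qed.

End SuspensionClass.

Lemma absz_sum_le (F : nat -> int) M k : (forall i, (i < k)%N -> (absz (F i) <= M)%N) ->
  (absz (\sum_(i < k) F i)%R <= k * M)%N.
Proof.
elim: k => [|k IH] FM; first by rewrite big_ord0.
rewrite big_ord_recr mulSn; have := FM k (ltnSn k).
have := IH (fun i ik => FM i (ltnW ik)); rewrite /=.
by move: (\sum_(i < k) _) (F k) (k * M)%N => u v n; lia.
Qed.

(** * The bijection of suspensions *)

Section Flow.
Variables (a b : finType) (X : one_sided_shift a) (Y : one_sided_shift b) (R : realType).
Variables (c : X -> int) (f : two_sided X -> two_sided Y) (N S : nat).
Local Notation csum := (csum c).
Hypothesis fc : continuous f.
Hypothesis f_shift : forall k x, f (zshift_map k x) = zshift_map (csum x k) (f x).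
Hypothesis f_eq : forall x x' j, f x = zshift_map j (f x') ->
  exists n, x = zshift_map n x' /\ csum x' n = j.
Hypothesis f_surj : forall y, exists x j, y = zshift_map j (f x).
Hypothesis cl : forall n, exists M, forall x z : two_sided X,
  zagree M (zletters x) (zletters z) -> csum x n = csum z n.
Hypotheses (N0 : (0 < N)%N) (cN : forall x, 1 <= birkhoff c N x <= (N * S)%N%:Z).
Implicit Types (x : two_sided X) (t r : R).

(* [csum x] need not be monotone, but its average over a window of length [N] is. *)
Definition avg_csum x (n : int) : R := N%:R^-1 * (\sum_(i < N) csum x (n + i%:Z))%:~R.

(** Moving the window by one replaces [csum x n] by [csum x (n + N)]: the increment is a sum of [c]
    over [N] steps, divided by [N]. *)
Lemma avg_csum_step x n : N%:R^-1 <= avg_csum x (n + 1) - avg_csum x n <= S%:R.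
Proof.
have NR : 0 < N%:R :> R by rewrite ltr0n.
have -> : avg_csum x (n + 1) - avg_csum x n = N%:R^-1 * (birkhoff c N (tail x n))%:~R.
  rewrite /avg_csum -mulrBr -rmorphB/=; congr (_ * _%:~R).
  have -> : birkhoff c N (tail x n) = csum x (n + N%:Z) - csum x n.
    by rewrite csumD addrAC subrr add0r.
  rewrite -sumrB; elim: N => [|k IH]; first by rewrite big_ord0 addr0 subrr.
  rewrite big_ord_recr/= IH (_ : n + 1 + k%:Z = n + k.+1%:Z); last lia.
  by rewrite addrAC addrCA subrr addr0.
have /andP[h1 h2] := cN (tail x n).
apply/andP; split.
  by rewrite -{1}[_^-1]mulr1 ler_pM2l ?invr_gt0// (ler_int R 1).
rewrite mulrC ler_pdivrMr//; apply: (@le_trans _ _ ((N * S)%N%:Z)%:~R); first by rewrite ler_int.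
by rewrite -pmulrn natrM mulrC.
Qed.

Lemma avg_csum_shift k x n : avg_csum (zshift_map k x) n = avg_csum x (n + k) - (csum x k)%:~R.
Proof.
have NR : N%:R != 0 :> R by rewrite pnatr_eq0 -lt0n.
rewrite /avg_csum.
have -> : \sum_(i < N) csum (zshift_map k x) (n + i%:Z) =
    \sum_(i < N) csum x (n + k + i%:Z) - csum x k *+ N.
  rewrite (eq_bigr (fun i : 'I_N => csum x (n + k + i%:Z) - csum x k)).
    by rewrite sumrB sumr_const card_ord.
  by move=> i _; rewrite csum_shift addrAC.
by rewrite rmorphB/= mulrBr rmorphMn/= -(mulr_natl (csum x k)%:~R N) mulKf.
Qed.

Lemma avg_csum_near x n : \forall z \near x, avg_csum z n = avg_csum x n.
Proof.
have near_csum k : \forall z \near x, csum z k = csum x k.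
  have [M MP] := cl k; have := cylinder_nbhs absz_finite x M.
  by apply: filterS => z xz; apply/esym/MP.
have : \forall z \near x, forall i : 'I_N, csum z (n + i%:Z) = csum x (n + i%:Z).
  apply: (filter_forall (F := nbhs x)
    (f := fun (i : 'I_N) z => csum z (n + i%:Z) = csum x (n + i%:Z)) _) => i.
  exact: near_csum.
by apply: filterS => z zx; rewrite /avg_csum; congr (_ * _%:~R); apply: eq_bigr.
Qed.

Definition time x t : R := pl (avg_csum x) t.

Lemma time_shift k x t : time (zshift_map k x) t = time x (t + k%:~R) - (csum x k)%:~R.
Proof.
rewrite /time -pl_shift -pl_addc; congr (pl _ t).
by apply/funext => n; rewrite avg_csum_shift.
Qed.

Let slope0 : 0 < N%:R^-1 :> R. Proof. by rewrite invr_gt0 ltr0n. Qed.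

Lemma time_lt x t t' : t < t' -> time x t < time x t'.
Proof. exact: (pl_lt slope0 (avg_csum_step x)). Qed.

Lemma time_inj x : injective (time x).
Proof. exact: (pl_inj slope0 (avg_csum_step x)). Qed.

Lemma time_surj x r : exists t, time x t = r.
Proof. exact: (pl_surj slope0 (avg_csum_step x)). Qed.

Definition flow_map (p : (two_sided X * R)%type) : (two_sided Y * R)%type :=
  (f p.1, time p.1 p.2).

Lemma flow_map_continuous : continuous flow_map.
Proof.
move=> [x t].
have cf : (fun p : two_sided X * R => f p.1) @ (x, t) --> f x.
  by apply: (@cvg_comp _ _ _ fst f _ (nbhs x)); [exact: cvg_fst|exact: fc].
suff ct : (fun p : two_sided X * R => time p.1 p.2) @ (x, t) --> time x t.
  exact: (cvg_pair cf ct).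
apply/cvgrPdist_le => e e0.
(* At fixed [t] only two averages enter, both locally constant in the point; the dependence on [t]
   has a Lipschitz constant [S] common to all points. *)
have nx : \forall z \near x, time z t = time x t.
  near=> z; have zx n : n \in [:: Num.floor t; Num.floor t + 1] -> avg_csum z n = avg_csum x n.
    by rewrite !inE => /orP[] /eqP ->; near: z; exact: avg_csum_near.
  by rewrite /time /pl !zx// !inE eqxx ?orbT.
have nt : \forall t' \near t, S%:R * `|t - t'| <= e.
  pose d := e / (S%:R + 1).
  have d0 : 0 < d by rewrite divr_gt0// ltr_wpDl.
  have := nbhsx_ballx t d d0; apply: filterS => t' /ltW h; apply: (@le_trans _ _ ((S%:R + 1) * `|t - t'|)).
    by rewrite ler_wpM2r// lerDl.
  by rewrite mulrC -ler_pdivlMr// ltr_wpDl.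
have : \forall p \near (x, t), time p.1 t = time x t /\ S%:R * `|t - p.2| <= e.
  by exists ([set z | time z t = time x t], [set t' | S%:R * `|t - t'| <= e]).
apply: filterS => -[z t'] /= [<- h]; apply: le_trans h.
exact: (pl_lipschitz slope0 (avg_csum_step z)).
Unshelve. all: by end_near. Qed.

Definition flow_class (p : (two_sided X * R)%type) : suspension Y R :=
  suspension_class (flow_map p).1 (flow_map p).2.

Lemma flow_class_proper x t y r : suspension_class x t = suspension_class y r ->
  flow_class (x, t) = flow_class (y, r).
Proof.
move=> /suspension_class_eq[n [-> ->]]; apply/suspension_class_eq.
by exists (csum y n); split; rewrite /= ?f_shift ?time_shift ?subrK.
Qed.

(** [f_eq] gives a shift whose sum is exactly [j]; both times then become values of [time y], which
    is injective. *)
Lemma flow_class_inj x t y r : flow_class (x, t) = flow_class (y, r) ->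
  suspension_class x t = suspension_class y r.
Proof.
move=> /suspension_class_eq[j [/= /f_eq[n [-> nj]] tr]].
apply/suspension_class_eq; exists n; split=> //.
by apply: (@time_inj y); rewrite tr time_shift nj subrK.
Qed.

Definition flow (q : suspension X R) : suspension Y R := flow_class (repr q).

Lemma flowE x t : flow (suspension_class x t) = suspension_class (f x) (time x t).
Proof.
rewrite -[RHS]/(flow_class (x, t)) /flow; case E : (repr _) => [y r].
by apply: flow_class_proper; rewrite /suspension_class -E reprK.
Qed.

Lemma flow_inj : injective flow.
Proof.
move=> p q; have [x [t ->]] := suspension_classP p; have [y [r ->]] := suspension_classP q.
by rewrite !flowE => /flow_class_inj.
Qed.

Lemma flow_surj q : exists p, flow p = q.
Proof.
have [y [r ->]] := suspension_classP q; have [x [j ->]] := f_surj y.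
have [t tr] := time_surj x (r + j%:~R); exists (suspension_class x t).
by rewrite flowE tr; apply/esym/suspension_class_eq; exists j.
Qed.

Lemma flow_continuous : continuous flow.
Proof.
apply/quotient_continuous => p.
have -> : flow \o \pi_{eq_quot suspension_equiv X R} =
    (\pi_{eq_quot suspension_equiv Y R} : _ -> suspension Y R) \o flow_map.
  apply/funext => -[x t]; exact: flowE.
by apply: continuous_comp; [exact: flow_map_continuous|exact: pi_continuous].
Qed.

Lemma time_unit_bounded (Bc : nat) : (forall x : X, (absz (c x) <= Bc)%N) ->
  exists K : nat, forall x t, 0 <= t <= 1 -> `|time x t| <= K%:R.
Proof.
move=> cB; exists (N * Bc + S)%N => x t /andP[t0 t1].
have NR : 0 < N%:R :> R by rewrite ltr0n.
have b0 : `|time x 0| <= (N * Bc)%N%:R.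
  have -> : time x 0 = avg_csum x 0 by rewrite /time -[X in pl _ X]/(0%:~R) pl_int.
  rewrite /avg_csum normrM gtr0_norm// mulrC ler_pdivrMr// -natrM.
  rewrite -intr_norm -abszE -pmulrn ler_nat.
  have cb (k : nat) : (k <= N)%N -> (absz (csum x (0 + k%:Z)) <= N * Bc)%N.
    move=> kN; suff : (absz (csum x (0 + k%:Z)) <= k * Bc)%N by nia.
    rewrite csumD csum0 add0r; elim: k {kN} => [|k IH]; first by rewrite birkhoff0.
    by rewrite birkhoffS; have := cB (iter k (@shift_map _ X) (tail x 0)); lia.
  rewrite mulnC; apply: (@absz_sum_le (fun i => csum x (0 + i%:Z))) => i iN.
  exact: cb (ltnW iN).
have := pl_lipschitz slope0 (avg_csum_step x) t 0.
rewrite subr0 (ger0_norm t0) -/(time _ _) -/(time _ _) => h.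
rewrite -[time x t](subrK (time x 0)) natrD addrC.
apply: le_trans (ler_normD _ _) _; apply: lerD => //; apply: le_trans h _.
by rewrite ler_piMr.
Qed.

(** For a bijection this is continuity of the inverse. Representatives with time in [[0, 1]] reduce
    the image to a compact set [D] and its translates. *)
Lemma flow_closed C : (exists Bc : nat, forall x : X, (absz (c x) <= Bc)%N) ->
  closed C -> closed (flow @` C).
Proof.
move=> [Bc /time_unit_bounded[K KP]] cC.
pose piX := \pi_{eq_quot suspension_equiv X R} : _ -> suspension X R.
pose piY := \pi_{eq_quot suspension_equiv Y R} : _ -> suspension Y R.
pose D := flow_map @` (piX @^-1` C `&` (setT `*` `[0, 1])).
have cD : closed D.
  apply: compact_closed.
    by apply: hausdorff_prod; [exact: two_sided_hausdorff|exact: Rhausdorff].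
  apply: continuous_compact; first exact/continuous_subspaceT/flow_map_continuous.
  rewrite setIC; apply: compact_closedI.
    by apply: compact_setX; [exact: two_sided_compact|exact: segment_compact].
  by have /continuous_closedP := @pi_continuous _ {eq_quot suspension_equiv X R}; apply.
pose s (n : int) (p : (two_sided Y * R)%type) := (zshift_map n p.1, p.2 - n%:~R).
have sc n : continuous (s n).
  move=> [y r].
  have c1 : (fun p : two_sided Y * R => zshift_map n p.1) @ (y, r) --> zshift_map n y.
    apply: (@cvg_comp _ _ _ fst (zshift_map n) _ (nbhs y)); first exact: cvg_fst.
    exact: zshift_map_continuous.
  have c2 : (fun p : two_sided Y * R => p.2 - n%:~R) @ (y, r) --> r - n%:~R.
    by apply: cvgB; [exact: cvg_snd|exact: cvg_cst].
  exact: (cvg_pair c1 c2).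
(* The preimage of [flow @` C] is the union of the translates [s n @^-1` D] of a
   compact set, and this union is locally finite. *)
have PE p : (flow @` C) (piY p) <-> exists n, D (s n p).
  case: p => y r; split.
    move=> [q Cq]; have [x [t qxt]] := suspension_classP q.
    have [x' [t' [t'01 e]]] := suspension_class_unit x t.
    rewrite qxt e flowE => /suspension_class_eq[n [xy rt]]; exists n, (x', t').
      split; first by rewrite /= -[X in C X]/(suspension_class x' t') -e -qxt.
      by split=> //=; rewrite in_itv.
    by rewrite /s /flow_map /= -xy rt addrK.
  move=> [n [[x t] [Cxt _] [fx tx]]]; exists (piX (x, t)) => //.
  rewrite -[LHS]/(flow (suspension_class x t)) flowE; apply/suspension_class_eq.
  by exists n; rewrite fx tx subrK.
rewrite -openC; change (open (piY @^-1` (~` (flow @` C)))).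
rewrite preimage_setC openC => -[y r] clp; apply/PE.
(* If the translate by [n] meets the unit ball around [r], then [r' - n] is a time of size at most
   [K], which bounds [n]. *)
have [l lP] := absz_finite (K + Num.truncn `|r| + 3)%N.
have : closure (\bigcup_(n in [set` l]) (s n @^-1` D)) (y, r).
  move=> U Up.
  have Vp : nbhs (y, r) (setT `*` ball r 1).
    by exists (setT, ball r 1) => //; split=> //=; [exact: filterT|exact: nbhsx_ballx].
  have [[y' r'] [/PE[n Dn] [Up' [/= _ rr']]]] := clp _ (filterI Up Vp).
  exists (y', r'); split=> //; exists n => //=; apply: lP.
  have [[x t] [_ [_ t01]] [_ /= tx]] := Dn.
  have := KP x t; rewrite tx; move: t01; rewrite /= in_itv/= => -> /(_ isT) h.
  move: rr'; rewrite /ball/= => rr'.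
  have hr : `|r| < (Num.truncn `|r|).+1%:R by rewrite truncnS_gt.
  rewrite -(ltr_nat R) natr_absz intr_norm.
  have -> : n%:~R = r - (r - r') - (r' - n%:~R) :> R by ring.
  apply: le_lt_trans (ler_normB _ _) _.
  apply: le_lt_trans (lerD (ler_normB _ _) (lexx _)) _.
  move: hr; rewrite !natrD -natr1; lra.
have := @closed_bigcup _ _ [set` l] (fun n => s n @^-1` D) (finite_seq l).
move=> /(_ _)/[apply]-[]; last by move=> n _ ?; exists n.
by move=> n _; have /continuous_closedP := sc n; apply.
Qed.

End Flow.

(** * Assembly of the flow equivalence *)

Theorem theorem4p1 (R : realType) (a b : finType)
    (X : one_sided_shift a) (Y : one_sided_shift b) :
  is_sft X -> is_sft Y -> continuously_orbit_equivalent X Y ->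
  flow_equivalent R X Y.
Proof.
move=> /sft_memory[m Xm] /sft_memory[m' Ym].
move=> [h [g [k [l [k' [l' [[hcont gcont hK gK] [kc lc] [kc' lc'] hkl gkl]]]]]]].
have hu := continuous_uniform hcont; have gu := continuous_uniform gcont.
have hc0 := orbit_cocycle kc lc hkl; have gc := orbit_cocycle kc' lc' gkl.
have [c [hc c_exact]] := exact_cocycle_ex hK gK hu gu hc0 gc Xm Ym.
have [N N0 c_pos] := birkhoff_pos Xm hc.1 (fun x p px => (c_exact x p px).1).
have [Bl c_lag] := hc.2.
have [Bc c_bound] : exists Bc : nat, forall x, (absz (c x) <= Bc)%N.
  apply: locally_const_bounded; have [M MP] := hc.1.
  by exists M => x z /MP ->.
have c_step x : 1 <= birkhoff c N x <= (N * Bc)%N%:Z.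
  rewrite c_pos /=; elim: N {N0 c_pos} => [|n IH]; first by rewrite birkhoff0.
  by rewrite birkhoffS; have := c_bound (iter n (@shift_map _ X) x); lia.
pose f : two_sided X -> two_sided Y := code N0 c_pos c_lag c_bound.
have fc : continuous f by exact: code_continuous hu hc _ _ _ _ _ _ _.
have f_shift k0 x : f (zshift_map k0 x) = zshift_map (csum c x k0) (f x).
  exact: code_shift.
have f_eq x x' j : f x = zshift_map j (f x') ->
    exists n, x = zshift_map n x' /\ csum c x' n = j.
  by rewrite /f => H; exact: (code_eq hK gc c_exact H).
have f_surj y : exists x j, y = zshift_map j (f x).
  exact: code_surj gK hu hc _ _ _ _ _ _ _ _.
have cl n : exists M, forall x z : two_sided X,
    zagree M (zletters x) (zletters z) -> csum c x n = csum c z n.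
  exact: csum_locally_const n hc.1.
pose psi := @flow _ _ X Y R c f N.
have psi_inj : injective psi by exact: (flow_inj f_shift f_eq N0 c_step).
have psiE : forall x t, psi (suspension_class x t) = suspension_class (f x) (time c N x t).
  exact: flowE f_shift N0.
have /choice[psiinv psiK] : forall q, exists p, psi p = q.
  exact: (flow_surj f_shift f_surj N0 c_step).
have psiinvK : cancel psi psiinv by move=> p; apply: psi_inj; rewrite psiK.
exists psi, psiinv; split.
  split=> //; first exact: (flow_continuous fc f_shift cl N0 c_step).
  apply/continuous_closedP => C cC.
  have -> : psiinv @^-1` C = psi @` C.
    apply/seteqP; split=> [q Cq|_ [p Cp <-]]; first by exists (psiinv q).
    by rewrite /= psiinvK.
  by apply: (flow_closed fc f_shift cl N0 c_step) => //; exists Bc.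
move=> x t y r; rewrite psiE => xy s u s0 u0; split.
  exists (time c N x (t + s) - time c N x t).
    by rewrite subr_gt0; apply: (time_lt N0 c_step); rewrite ltrDl.
  rewrite psiE -(suspension_class_shift _ xy); congr suspension_class.
  by ring.
have [t' tt'] := time_surj N0 c_step x (time c N x t + u).
exists (t' - t).
  rewrite subr_gt0 ltNge; apply/negP; rewrite le_eqVlt => /orP[/eqP e|/(time_lt N0 c_step x)].
    by move: tt'; rewrite e; lra.
  by rewrite tt'; lra.
apply: psi_inj; rewrite psiK -(suspension_class_shift u xy) psiE -tt'.
by congr (suspension_class _ (time _ _ _ _)); ring.
Qed.
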